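(* Let $v$ be a weight on $\mathbb{R}^{n}$ and let $\vec{w}=(w_{1},w_{2})$ be a pair of weights on $\mathbb{R}^{n}$. Assume that $$0\leq\alpha<n,\quad 0<q\leq p<\infty,\quad 0<t\leq s<r\leq\infty,\quad \vec q=(q_1,q_2),\quad 0<r_{i}<q_{i}<\infty\ (i=1,2),$$ and $1<a<\min(q_{1}/r_{1},q_{2}/r_{2})$, where $1/q=1/q_{1}+1/q_{2}$, and put $\vec R=(r_1,r_2)$. Suppose that $$\frac{\alpha}{n}\geq\frac{1}{r},\quad\frac{1}{s}=\frac{1}{p}+\frac{1}{r}-\frac{\alpha}{n},\quad\frac{t}{s}=\frac{q}{p},$$ and that $$[v,\vec{w}]_{t,\vec{q}/a}^{r,s}=\sup_{\substack{Q,Q'\in\mathcal{D}(\mathbb{R}^{n})\\ Q\subseteq Q'}}\left(\frac{|Q|}{|Q'|}\right)^{\frac{1}{s}}|Q'|^{\frac{1}{r}}\left(\frac1{|Q|}\int_{Q}v^{t}\right)^{\frac{1}{t}}\prod_{i=1}^{2}\left(\frac1{|Q'|}\int_{Q'}w_{i}^{-r_{i}\left(\frac{q_{i}}{ar_{i}}\right)'}\right)^{\frac{1}{r_{i}\left(\frac{q_{i}}{ar_{i}}\right)'}}<\infty.$$ Then $$\|M_{\alpha,\vec{R}}(f,g)v\|_{\mathcal{M}_{t}^{s}}\leq C[v,\vec{w}]_{t,\vec{q}/a}^{r,s} \sup_{Q\in\mathcal{D}(\mathbb{R}^{n})}|Q|^{1/p}\left(\frac1{|Q|}\int_{Q}(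|f|w_{1})^{q_{1}}\right)^{1/q_{1}}\left(\frac1{|Q|}\int_{Q}(|g|w_{2})^{q_{2}}\right)^{1/q_{2}}.$$
   Context: $C$ denotes a constant independent of the essential variables (in particular of $f$ and $g$); $f,g$ are measurable functions on $\mathbb{R}^n$. For $1<u<\infty$, $u'=u/(u-1)$. ''Weight'' has its usual meaning (a nonnegative locally integrable function). $\mathcal{D}(\mathbb{R}^{n})=\{2^{-k}([0,1)^{n}+m):k\in\mathbb{Z},\,m\in\mathbb{Z}^{n}\}$ is the set of dyadic cubes. For $\vec R=(r_1,r_2)$, $$M_{\alpha,\vec{R}}(f,g)(x)=\sup_{\mathcal{D}(\mathbb{R}^{n})\ni Q\ni x}|Q|^{\frac{\alpha}{n}}\left(\frac1{|Q|}\int_{Q}|f|^{r_{1}}\right)^{\frac{1}{r_{1}}}\left(\frac1{|Q|}\int_{Q}|g|^{r_{2}}\right)^{\frac{1}{r_{2}}}.$$ For $0<t\le s<\infty$, $\|h\|_{\mathcal{M}_{t}^{s}}=\sup_{Q\in\mathcal{D}(\mathbb{R}^{n})}|Q|^{1/s}\left(\frac{1}{|Q|}\int_{Q}|h|^{t}\right)^{1/t}$. *)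

(* Defs.v *)
From HB Require Import structures.
From mathcomp Require Import all_boot all_order all_algebra.
From mathcomp Require Import all_classical all_reals all_analysis.
From mathcomp Require Import measurable_realfun.

Set Implicit Arguments.
Unset Strict Implicit.
Unset Printing Implicit Defensive.

Import Order.TTheory GRing.Theory Num.Theory.
Import numFieldNormedType.Exports.

Local Open Scope classical_set_scope.
Local Open Scope ring_scope.
Local Open Scope ereal_scope.

Section cons_measure.
Context d (T : measurableType d) (R : realType) (n : nat).
Variable m1 : {sigma_finite_measure set T -> \bar R}.
Variable m2 : {sigma_finite_measure set (n.-tuple T) -> \bar R}.

Definition pair_cons (z : T * n.-tuple T) : n.+1.-tuple T :=
  [tuple of z.1 :: z.2].

Lemma measurable_pair_cons : measurable_fun setT pair_cons.
Proof. exact: measurable_cons. Qed.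

Definition cons_measure (A : set (n.+1.-tuple T)) : \bar R :=
  pushforward (m1 \x m2) pair_cons A.

Let cons_measure0 : cons_measure set0 = 0.
Proof. by rewrite /cons_measure /pushforward preimage_set0 measure0. Qed.

Let cons_measure_ge0 A : 0 <= cons_measure A.
Proof. exact: (measure_ge0 (m1 \x m2)). Qed.

Let cons_measure_sigma_additive : semi_sigma_additive cons_measure.
Proof.
move=> F mF tF mUF; rewrite /cons_measure /pushforward preimage_bigcup.
have mpre A : measurable A -> measurable (pair_cons @^-1` A).
  by move=> mA; rewrite -[X in measurable X]setTI; exact: measurable_pair_cons.
apply: measure_semi_sigma_additive.
- by move=> k; exact: mpre.
- apply/trivIsetP => /= i j _ _ ij; rewrite -preimage_setI.
  by move/trivIsetP : tF => /(_ _ _ _ _ ij) ->//; rewrite preimage_set0.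
- by rewrite -preimage_bigcup; exact: mpre.
Qed.

HB.instance Definition _ := isMeasure.Build _ _ _ cons_measure
  cons_measure0 cons_measure_ge0 cons_measure_sigma_additive.

Let cons_measure_sigma_finite : sigma_finite setT cons_measure.
Proof.
have /sigma_finiteP[F [TF ndF Foo]] := sigma_finiteT m1.
have /sigma_finiteP[G [TG ndG Goo]] := sigma_finiteT m2.
pose unc (x : n.+1.-tuple T) := (tnth x ord0, [tuple of behead x] : n.-tuple T).
have munc : measurable_fun setT unc.
  by apply: measurable_fun_pair => //=;
    [exact: measurable_tnth|exact: measurable_behead].
have uncK z : unc (pair_cons z) = z.
  by case: z => x t; congr pair; apply: val_inj.
exists (fun k => unc @^-1` (F k `*` G k)).
  rewrite -preimage_bigcup (_ : \bigcup_k _ = setT) ?preimage_setT //.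
  rewrite -subTset => -[x y] _.
  have [i _ Fx] : (\bigcup_i F i) x by rewrite -TF.
  have [j _ Gy] : (\bigcup_j G j) y by rewrite -TG.
  exists (maxn i j) => //; split.
    by move: x Fx; exact/subsetPset/ndF/leq_maxl.
  by move: y Gy; exact/subsetPset/ndG/leq_maxr.
move=> k; have [mF Fk] := Foo k; have [mG Gk] := Goo k; split.
  by rewrite -[X in measurable X]setTI; apply: munc => //; exact: measurableX.
rewrite /cons_measure /pushforward -comp_preimage.
rewrite (_ : unc \o pair_cons = id) ?preimage_id; last first.
  by apply/funext => z /=; rewrite uncK.
by rewrite product_measure1E// lte_mul_pinfty// ge0_fin_numE.
Qed.

HB.instance Definition _ := Measure_isSigmaFinite.Build _ _ _ cons_measure
  cons_measure_sigma_finite.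

End cons_measure.

Fixpoint power_measure d (T : measurableType d) (R : realType)
    (m : {sigma_finite_measure set T -> \bar R}) (n : nat) :
    {sigma_finite_measure set (n.-tuple T) -> \bar R} :=
  match n with
  | 0%N => dirac ([tuple] : 0.-tuple T)
  | n'.+1 => cons_measure m (power_measure m n')
  end.

Lemma power_measure_box d (T : measurableType d) (R : realType)
    (m : {sigma_finite_measure set T -> \bar R}) n (A : 'I_n -> set T) :
  (forall i, measurable (A i)) ->
  power_measure m n [set x | forall i, A i (tnth x i)] = \prod_(i < n) m (A i).
Proof.
elim: n A => [|n IH] A mA.
  by rewrite big_ord0 /= diracE mem_set// => -[].
rewrite big_ord_recl -IH// -product_measure1E //; last first.
  rewrite (_ : mkset _ = \bigcap_(i in [set: 'I_n]) ((@tnth n T ^~ i) @^-1` A (lift ord0 i))); last first.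
    by apply/seteqP; split => [x h i _|x h i]; [exact: h|exact: (h i Logic.I)].
  apply: fin_bigcap_measurable => // i _.
  by rewrite -[X in measurable X]setTI; exact: measurable_tnth.
rewrite /= /cons_measure /pushforward; congr (_ _).
apply/seteqP; split => -[x t] /=.
  by move=> h; split => [|i]; [have := h ord0|have := h (lift ord0 i); rewrite tnthS].
move=> [h0 h] i; case: (unliftP ord0 i) => [j|] ->; rewrite ?tnthS//; exact: h.
Qed.

Definition borel_lebesgue_Rn (R : realType) (n : nat) :
    {sigma_finite_measure set (n.-tuple (measurableTypeR R)) -> \bar R} :=
  power_measure (@lebesgue_measure R) n.

(* R^n with the sigma-algebra of Lebesgue measurable sets, i.e. the completion
   (by Caratheodory's construction) of the product Borel sigma-algebra *)
Definition Rn (R : realType) (n : nat) :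
    measurableType (caratheodory_display (mu_ext (borel_lebesgue_Rn R n))) :=
  caratheodory_type (mu_ext (borel_lebesgue_Rn R n)).

Definition lebesgue_Rn (R : realType) (n : nat) :
    {measure set (Rn R n) -> \bar R} :=
  @completed_measure_extension _ _ R (borel_lebesgue_Rn R n).

Section weighted_morrey.
Context (R : realType) (n : nat).
Notation mu := (@lebesgue_Rn R n).
Implicit Types (Q : set (Rn R n)) (w : Rn R n -> R) (f g h : Rn R n -> \bar R).

(* compactness is taken in 'rV[R]_n, as tuples carry no topology *)
Definition locally_integrable_Rn w :=
  measurable_fun setT w /\
  forall K : set (Rn R n),
    compact [set \row_i tnth (x : n.-tuple R) i | x in K] ->
    \int[mu]_(x in K) `|w x|%:E < +oo.

Definition weight w := (forall x, (0 <= w x)%R) /\ locally_integrable_Rn w.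

Definition dyadic_cube (k : int) (m : 'I_n -> int) : set (Rn R n) :=
  [set x | forall i, (2 ^ (- k) * (m i)%:~R <= tnth (x : n.-tuple R) i
                        < 2 ^ (- k) * ((m i)%:~R + 1))%R].

Definition dyadic : set (set (Rn R n)) :=
  [set Q | exists k m, Q = dyadic_cube k m].

Definition Lavg (u : R) Q h : \bar R :=
  ((mu Q)^-1 * \int[mu]_(x in Q) `|h x| `^ u) `^ u^-1.

Definition frac_maximal (alpha r1 r2 : R) f g : Rn R n -> \bar R := fun x =>
  ereal_sup [set mu Q `^ (alpha / n%:R) * Lavg r1 Q f * Lavg r2 Q g
            | Q in [set Q | dyadic Q /\ Q x]].

Definition morrey_norm (t s : R) h : \bar R :=
  ereal_sup [set mu Q `^ s^-1 * Lavg t Q h | Q in dyadic].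

Definition conj_exp (u : R) : R := (u / (u - 1))%R.

(* here 1/r = 0 for r = +oo; w^-e is written (1/w)^e in the extended reals, so
   that it is +oo where w vanishes, whereas the library's 0 `^ (- e) is 0 *)
Definition weight_const (t : R) (q1 q2 : R) (a : R) (r1 r2 : R)
    (r : \bar R) (s : R) (v w1 w2 : Rn R n -> R) : \bar R :=
  let e1 := (r1 * conj_exp (q1 / (a * r1)))%R in
  let e2 := (r2 * conj_exp (q2 / (a * r2)))%R in
  ereal_sup [set y | exists Q Q', [/\ dyadic Q, dyadic Q', Q `<=` Q' &
    y = (mu Q / mu Q') `^ s^-1 * mu Q' `^ fine r^-1 *
        Lavg t Q (EFin \o v) *
        (Lavg e1 Q' (fun x => (w1 x)%:E^-1) *
         Lavg e2 Q' (fun x => (w2 x)%:E^-1))]].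

Definition bi_morrey_norm (p q1 q2 : R) f g : \bar R :=
  ereal_sup [set mu Q `^ p^-1 * Lavg q1 Q f * Lavg q2 Q g | Q in dyadic].

End weighted_morrey.

(* Main.v *)
Require Import Defs.
From mathcomp Require Import all_boot all_order all_algebra ssrAC.
From mathcomp Require Import all_classical all_reals all_analysis.
From mathcomp Require Import measurable_realfun.
From mathcomp Require Import ring lra.

Import Order.TTheory GRing.Theory Num.Theory.
Import numFieldNormedType.Exports.

Local Open Scope classical_set_scope.
Local Open Scope ring_scope.

(** The estimate is proved one dyadic cube [Q0] at a time. Write [<h>_(u,Q)] for the
    power mean of [h] over [Q], [K] for the weight constant, [N] for the bilinear
    Morrey norm, [A(Q) = |Q|^(alpha/n) <f>_(r1,Q) <g>_(r2,Q)], [F = |f| w1],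
    [G = |g| w2]. If [v] vanishes almost everywhere on [Q0] there is nothing to
    prove; otherwise [K < oo] forces the weights to be positive almost everywhere on
    all cubes comparable with [Q0], and Holder's inequality bounds [A(Q)] by
    [|Q|^(alpha/n) <F>_(q1/a,Q) <G>_(q2/a,Q)] times the means of [1/w1] and [1/w2].

    For the cubes [Q] containing [Q0] this and the definition of [K] give
    [|Q0|^(1/s) <v>_(t,Q0) A(Q) <= K N] directly ([large_cube_le]). Hence, if [N < oo], the
    supremum [c] of these [A(Q)] is finite, and on [Q0] the maximal function is the maximum of
    [c] and of the [A(Q)] with [Q] contained in [Q0].

    For the small cubes, taking [Q = Q'] in [K] and interpolating as Adams does
    between the Morrey norm and the plain averages gives [small_cube_key]:
    [A(Q)^t <v>_(t,Q)^t <= K^t N^(t-q) (<F>_(q1/a,Q) <G>_(q2/a,Q))^q], and by weighted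
    AM-GM the last power is at most a combination of [phi_Q^a] and [psi_Q^a], where
    [phi_Q], [psi_Q] are the averages of [F^(q1/a)] and [G^(q2/a)]. It remains to
    integrate a supremum of values [A(Q)^t] against the measure [v^t]. The power
    [P = A^sg], [1/sg = 1/r1 + 1/r2], decreases in average from a cube to its children
    ([small_cube_super], by Holder's inequality for finite sums), so stopping each
    time [P] doubles selects a Carleson family of cubes, and the Carleson embedding
    theorem in [L^a] concludes, since [a > 1]. Selection and embedding are carried out
    together by an induction on the number of generations ([integral_cube_max_le])
    with the explicit Bellman function
    [Phi - phi^a / (1 + min(2, P/rho))^(a-1)], where [rho] is the current stopping
    threshold and [Phi] the average of the [a]-th power; one step ([bellman_step])
    is the convexity of the perspective function [z^a / y^(a-1)]. Monotone convergence
    removes the bound on the number of generations. *)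

(** * Convexity inequalities over the reals *)

Lemma weighted_amgm {R : realType} (tau x y : R) :
  (0 < tau < 1)%R -> (0 <= x)%R -> (0 <= y)%R ->
  (x `^ tau * y `^ (1 - tau) <= tau * x + (1 - tau) * y)%R.
Proof.
move=> /andP[t0 t1] x0 y0.
have u0 : (0 < 1 - tau)%R by rewrite subr_gt0.
have := @conjugate_powR R (x `^ tau) (y `^ (1 - tau)) tau^-1 (1 - tau)^-1
  (powR_ge0 _ _) (powR_ge0 _ _).
rewrite !invr_gt0 => /(_ t0 u0).
rewrite !invrK -!powRrM !mulfV ?gt_eqF// !powRr1// => h.
by rewrite (mulrC tau) (mulrC (1 - tau)%R); apply: h; lra.
Qed.

(** The homogeneous form, which is what is integrated or summed. *)
Lemma weighted_amgm_normalized {R : realType} (tau x y X Y : R) :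
  (0 < tau < 1)%R -> (0 <= x)%R -> (0 <= y)%R -> (0 < X)%R -> (0 < Y)%R ->
  (x `^ tau * y `^ (1 - tau) <=
   X `^ tau * Y `^ (1 - tau) * (tau * (x / X) + (1 - tau) * (y / Y)))%R.
Proof.
move=> ht x0 y0 X0 Y0.
have h := @weighted_amgm R tau (x / X) (y / Y) ht (divr_ge0 x0 (ltW X0))
  (divr_ge0 y0 (ltW Y0)).
have {1}-> : x = (X * (x / X))%R by rewrite mulrC divfK// gt_eqF.
have {1}-> : y = (Y * (y / Y))%R by rewrite [RHS]mulrC divfK// gt_eqF.
have xX : (0 <= x / X)%R by rewrite divr_ge0// ltW.
have yY : (0 <= y / Y)%R by rewrite divr_ge0// ltW.
rewrite (powRM tau (ltW X0) xX) (powRM (1 - tau) (ltW Y0) yY).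
rewrite [leLHS](_ : _ = X `^ tau * Y `^ (1 - tau) *
  ((x / X) `^ tau * (y / Y) `^ (1 - tau)))%R; last by ring.
by rewrite ler_wpM2l// mulr_ge0 ?powR_ge0.
Qed.

Lemma finite_holder {R : realType} {E : finType} (p x y : E -> R) (tau : R) :
  (0 < tau < 1)%R -> (forall e, 0 <= p e)%R ->
  (forall e, 0 <= x e)%R -> (forall e, 0 <= y e)%R ->
  (\sum_e p e * (x e `^ tau * y e `^ (1 - tau)) <=
   (\sum_e p e * x e) `^ tau * (\sum_e p e * y e) `^ (1 - tau))%R.
Proof.
move=> ht p0 x0 y0; have /andP[t0 t1] := ht.
have px0 (z : E -> R) : (forall e, 0 <= z e)%R -> (0 <= \sum_e p e * z e)%R.
  by move=> z0; apply: sumr_ge0 => e _; rewrite mulr_ge0.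
set X := (\sum_e p e * x e)%R; set Y := (\sum_e p e * y e)%R.
have zero (z : E -> R) e : (forall e, 0 <= z e)%R -> (\sum_e p e * z e = 0)%R ->
    (p e * z e = 0)%R.
  move=> z0 /eqP; rewrite psumr_eq0 => [/allP/(_ e)|? _]; last by rewrite mulr_ge0.
  by rewrite mem_index_enum => /(_ isT)/eqP.
have [X0|X0] := eqVneq X 0%R.
  rewrite big1 ?mulr_ge0 ?powR_ge0// => e _.
  have /eqP := zero x e x0 X0; rewrite mulf_eq0 => /orP[] /eqP ->.
    by rewrite mul0r.
  by rewrite powR0 ?gt_eqF// mul0r mulr0.
have [Y0|Y0] := eqVneq Y 0%R.
  rewrite big1 ?mulr_ge0 ?powR_ge0// => e _.
  have /eqP := zero y e y0 Y0; rewrite mulf_eq0 => /orP[] /eqP ->.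
    by rewrite mul0r.
  by rewrite [(0 `^ _)%R]powR0 ?gt_eqF ?subr_gt0// !mulr0.
have {}X0 : (0 < X)%R by rewrite lt_neqAle eq_sym X0 px0.
have {}Y0 : (0 < Y)%R by rewrite lt_neqAle eq_sym Y0 px0.
apply: (@le_trans _ _ (\sum_e p e * (X `^ tau * Y `^ (1 - tau) *
    (tau * (x e / X) + (1 - tau) * (y e / Y)))))%R.
  by apply: ler_sum => e _; rewrite ler_wpM2l// weighted_amgm_normalized.
rewrite (eq_bigr (fun e => X `^ tau * Y `^ (1 - tau) *
  (tau / X * (p e * x e) + (1 - tau) / Y * (p e * y e))))%R; last first.
  by move=> e _; ring.
rewrite -mulr_sumr big_split/= -!mulr_sumr -/X -/Y !divfK ?gt_eqF//.
by rewrite addrC subrK mulr1.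
Qed.

Lemma powRV {R : realType} (x r : R) : (0 <= x)%R -> (x^-1 `^ r = (x `^ r)^-1)%R.
Proof. by move=> x0; rewrite -(powR_inv1 x0) -powRrM mulN1r powRN. Qed.

(** The perspective function z^a / y^(a-1) is convex and homogeneous of degree
    one: it lies above its tangent planes. *)
Lemma perspective_tangent {R : realType} (a c y z : R) :
  (1 < a)%R -> (0 <= c)%R -> (0 < y)%R -> (0 <= z)%R ->
  (a * c `^ (a - 1) * z - (a - 1) * c `^ a * y <= z `^ a / y `^ (a - 1))%R.
Proof.
move=> a1 c0 y0 z0; have a0 : (0 < a)%R by lra.
have ht : (0 < a^-1 < 1)%R by rewrite invr_gt0 a0/= invf_lt1.
have xx : (0 <= z `^ a / y `^ (a - 1))%R by rewrite divr_ge0 ?powR_ge0.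
have yy : (0 <= c `^ a * y)%R by rewrite mulr_ge0 ?powR_ge0// ltW.
have := weighted_amgm _ _ _ ht xx yy.
rewrite -powRN !powRM ?powR_ge0 ?(ltW y0)// -!powRrM.
have e1 : (a * (1 - a^-1) = a - 1)%R by rewrite mulrBr mulr1 mulfV// gt_eqF.
rewrite mulfV ?gt_eqF// powRr1// e1.
have -> : (- (a - 1) / a = - (1 - a^-1))%R by field; rewrite gt_eqF.
rewrite powRN powRN => h.
have h2 : (c `^ (a - 1) * z <= a^-1 * (z `^ a / y `^ (a - 1))
     + (1 - a^-1) * (c `^ a * y))%R.
  apply: le_trans h; rewrite [leRHS](_ : _ = z * c `^ (a-1) *
    (y `^ (1 - a^-1) / y `^ (1 - a^-1)))%R; last by ring.
  by rewrite divff ?mulr1 1?mulrC// gt_eqF// powR_gt0.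
have := ler_wpM2l (ltW a0) h2.
rewrite [(a * (_ + _))%R]mulrDr !mulrA mulfV ?gt_eqF// mul1r.
have -> : (a * (1 - a^-1) = a - 1)%R by [].
by move=> h3; rewrite lerBlDr.
Qed.

(** * One step of the Bellman induction *)

(** Averaging over the children increases the perspective function, with a gain
    proportional to the drop [delta] of the Carleson variable [m]. *)
Lemma perspective_step {R : realType} {E : finType} (p f m : E -> R) (a F M delta : R) :
  (1 < a)%R -> (forall e, 0 <= p e)%R -> (\sum_e p e = 1)%R ->
  (forall e, 0 <= f e)%R -> (forall e, 0 <= m e)%R ->
  F = (\sum_e p e * f e)%R -> (0 <= M)%R ->
  (\sum_e p e * m e + delta <= M)%R ->
  (F `^ a / (1 + M) `^ (a - 1) + (a - 1) * delta * (F `^ a / (1 + M) `^ a) <=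
   \sum_e p e * (f e `^ a / (1 + m e) `^ (a - 1)))%R.
Proof.
move=> a1 p0 p1 f0 m0 FE M0 hM.
have y0 : (0 < 1 + M)%R by rewrite ltr_pwDl.
have F0 : (0 <= F)%R by rewrite FE sumr_ge0// => e _; rewrite mulr_ge0.
set c := (F / (1 + M))%R.
have c0 : (0 <= c)%R by rewrite divr_ge0// ltW.
apply: (@le_trans _ _ (\sum_e p e *
    (a * c `^ (a - 1) * f e - (a - 1) * c `^ a * (1 + m e))))%R; last first.
  by apply: ler_sum => e _; rewrite ler_wpM2l// perspective_tangent// ltr_pwDl.
rewrite (eq_bigr (fun e => a * c `^ (a - 1) * (p e * f e) - (a - 1) * c `^ a * p e
  - (a - 1) * c `^ a * (p e * m e)))%R; last by move=> e _; ring.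
rewrite !sumrB -!mulr_sumr -FE p1 mulr1.
have ca : (F `^ a / (1 + M) `^ a = c `^ a)%R.
  by rewrite /c powRM ?invr_ge0 ?(ltW y0)// powRV// ltW.
have yy : ((1 + M) `^ a = (1 + M) `^ (a - 1) * (1 + M))%R.
  by rewrite mulrC mulr_powRB1//; [exact: ltW|lra].
have cc : (c `^ a = c `^ (a - 1) * c)%R by rewrite mulrC mulr_powRB1//; lra.
have e1 : (F `^ a / (1 + M) `^ (a - 1) = c `^ a * (1 + M))%R.
  by rewrite -ca yy invfM mulrA -mulrA mulVf ?mulr1// gt_eqF.
have e2 : (c `^ (a - 1) * F = c `^ a * (1 + M))%R.
  by rewrite cc -mulrA /c divfK// gt_eqF.
rewrite ca e1 -[(a * _ * F)%R]mulrA e2.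
set s := (\sum_e _)%R; set k := (c `^ a)%R.
have k0 : (0 <= (a - 1) * k)%R by rewrite mulr_ge0 ?powR_ge0// subr_ge0 ltW.
have := ler_wpM2l k0 hM; rewrite -/s; lra.
Qed.

(** The Carleson variable of the induction: with stopping threshold [rho], it
    bounds the proportion of stopping cubes still to be met below a cube with
    value [P]. *)
Definition carleson_var {R : realType} (P rho : R) : R := Num.min 2 (P / rho).

(** The Bellman function; [f] and [F] stand for the averages over a cube of a
    function and of its [a]-th power. *)
Definition bellman {R : realType} (a P rho f F : R) : R :=
  (F - f `^ a / (1 + carleson_var P rho) `^ (a - 1))%R.

Lemma carleson_var_ge0 {R : realType} (P rho : R) :
  (0 <= P)%R -> (0 < rho)%R -> (0 <= carleson_var P rho)%R.
Proof. by move=> P0 r0; rewrite le_min ler0n/= divr_ge0// ltW. Qed.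

Lemma carleson_var_step {R : realType} {E : finType} (p P : E -> R) (P0 rho : R) :
  (forall e, 0 <= p e)%R -> (\sum_e p e = 1)%R -> (0 < rho)%R ->
  (\sum_e p e * P e <= P0)%R ->
  let jump := (2 * rho < P0)%R in
  (\sum_e p e * carleson_var (P e) (if jump then P0 else rho) + jump%:R
   <= carleson_var P0 rho)%R.
Proof.
move=> p0 p1 r0 hP /=.
have le1 r : (0 < r)%R -> (\sum_e p e * carleson_var (P e) r <= P0 / r)%R.
  move=> rr0; apply: (@le_trans _ _ (\sum_e p e * (P e / r)))%R.
    by apply: ler_sum => e _; rewrite ler_wpM2l// ge_min lexx orbT.
  rewrite (eq_bigr (fun e => p e * P e / r))%R => [|e _]; last by rewrite mulrA.
  by rewrite -mulr_suml ler_wpM2r// invr_ge0 ltW.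
case: ltP => hj.
  have P00 : (0 < P0)%R by apply: lt_trans hj; rewrite mulr_gt0.
  apply: (@le_trans _ _ 2)%R.
    by have := le1 _ P00; rewrite divff ?gt_eqF//=; lra.
  by rewrite le_min lexx/= ler_pdivlMr// ltW.
rewrite addr0 le_min le1// andbT.
by apply: le_trans (le1 _ r0) _; rewrite ler_pdivrMr.
Qed.

Lemma bellman_ge0 {R : realType} (a P rho f F : R) :
  (1 < a)%R -> (0 <= P)%R -> (0 < rho)%R -> (0 <= f)%R -> (f `^ a <= F)%R ->
  (0 <= bellman a P rho f F)%R.
Proof.
move=> a1 P0 r0 f0 fF; rewrite subr_ge0; apply: le_trans fF.
rewrite ler_pdivrMr ?powR_gt0 ?ltr_pwDl ?carleson_var_ge0//.
rewrite ler_peMr ?powR_ge0//.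
have m0 := carleson_var_ge0 _ _ P0 r0.
have := @ge0_ler_powR R (a - 1) _ 1 (1 + carleson_var P rho).
rewrite powR1; apply; rewrite ?nnegrE ?subr_ge0 ?ler01 ?(ltW a1)//.
  by rewrite addr_ge0.
by rewrite lerDl.
Qed.

(** The factor by which the gain in [bellman_step] must be multiplied to absorb
    [(2 * P) ^ kappa], the level reached at a stopping cube. *)
Definition bellman_const {R : realType} (kappa a : R) : R :=
  (2 `^ kappa * 3 `^ a / (a - 1))%R.

Lemma bellman_const_ge0 {R : realType} (kappa a : R) :
  (1 < a)%R -> (0 <= bellman_const kappa a)%R.
Proof.
by move=> a1; rewrite divr_ge0 ?mulr_ge0 ?powR_ge0// subr_ge0 ltW.
Qed.

(** At a stopping cube, that is when [2 * rho < P0], the threshold is raised to [P0]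
    and the Bellman function gains a multiple of [f0 ^ a]. *)
Lemma bellman_step {R : realType} {E : finType} (p P f F : E -> R)
    (P0 rho f0 F0 a : R) :
  (1 < a)%R -> (forall e, 0 <= p e)%R -> (\sum_e p e = 1)%R -> (0 < rho)%R ->
  (forall e, 0 <= P e)%R -> (\sum_e p e * P e <= P0)%R ->
  (forall e, 0 <= f e)%R ->
  f0 = (\sum_e p e * f e)%R -> F0 = (\sum_e p e * F e)%R ->
  let jump := (2 * rho < P0)%R in
  (\sum_e p e * bellman a (P e) (if jump then P0 else rho) (f e) (F e)
   + jump%:R * ((a - 1) / 3 `^ a * f0 `^ a) <= bellman a P0 rho f0 F0)%R.
Proof.
move=> a1 p0 p1 r0 P0' hP f00 fE FE; cbv zeta; set jump := (2 * rho < P0)%R.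
set rho' := (if jump then P0 else rho).
have P00 : (0 <= P0)%R by apply: le_trans hP; apply: sumr_ge0 => e _; rewrite mulr_ge0.
have r0' : (0 < rho')%R.
  rewrite /rho' /jump; case: (ltP (2 * rho)%R) => // h; apply: lt_trans h.
  by rewrite mulr_gt0.
have cs := carleson_var_step p P P0 rho p0 p1 r0 hP.
have := @perspective_step R E p f (fun e => carleson_var (P e) rho') a f0
  (carleson_var P0 rho) (jump%:R) a1 p0 p1 f00
  (fun e => carleson_var_ge0 _ _ (P0' e) r0') fE (carleson_var_ge0 _ _ P00 r0) cs.
have -> : (\sum_e p e * bellman a (P e) rho' (f e) (F e) = F0 -
    \sum_e p e * (f e `^ a / (1 + carleson_var (P e) rho') `^ (a - 1)))%R.
  by rewrite FE -sumrB; apply: eq_bigr => e _; rewrite /bellman mulrBr.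
rewrite /bellman.
suff : (jump%:R * ((a - 1) / 3 `^ a * f0 `^ a) <= (a - 1) * jump%:R *
   (f0 `^ a / (1 + carleson_var P0 rho) `^ a))%R by lra.
rewrite /jump; case: ltP => h; last by rewrite !(mul0r, mulr0).
have -> : carleson_var P0 rho = 2%R.
  by apply/min_idPl; rewrite ler_pdivlMr// ltW.
have -> : (1 + 2 = 3 :> R)%R by ring.
by rewrite mul1r mulr1 mulrAC mulrA.
Qed.

Local Open Scope ereal_scope.

(** * Dyadic cubes *)

Section dyadic_cubes.
Context {R : realType} {n : nat}.
Local Notation mu := (lebesgue_Rn R n).
Implicit Types (k : int) (m : 'I_n -> int) (x y : Rn R n).

(** The projection of a dyadic cube on the [i]-th axis. *)
Definition dyadic_side k m (i : 'I_n) : set (measurableTypeR R) :=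
  `[(2 ^ (- k) * (m i)%:~R)%R, (2 ^ (- k) * ((m i)%:~R + 1))%R[%classic.

Lemma dyadic_cubeE k m :
  dyadic_cube k m = [set x | forall i, dyadic_side k m i (tnth (x : n.-tuple (measurableTypeR R)) i)].
Proof. by apply/seteqP; split => x h i; move: (h i); rewrite /dyadic_side /= in_itv. Qed.

Lemma measurable_dyadic_box k m :
  measurable [set x : n.-tuple (measurableTypeR R) | forall i, dyadic_side k m i (tnth x i)].
Proof.
rewrite (_ : mkset _ = \bigcap_(i in [set: 'I_n])
    ((@tnth n (measurableTypeR R) ^~ i) @^-1` dyadic_side k m i)); last first.
  by apply/seteqP; split => [x h i _|x h i]; [exact: h|exact: (h i Logic.I)].
apply: fin_bigcap_measurable => // i _.
rewrite -[X in measurable X]setTI; apply: measurable_tnth => //.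
exact: measurable_itv.
Qed.

Lemma measurable_dyadic_cube k m : measurable (dyadic_cube k m : set (Rn R n)).
Proof.
rewrite dyadic_cubeE; apply: caratheodory_measurable_mu_ext.
exact: measurable_dyadic_box.
Qed.

(** The volume of the cubes of generation [k]. *)
Definition dyadic_vol k : R := ((2 ^ (- k)) ^+ n)%R.

Lemma dyadic_vol_gt0 k : (0 < dyadic_vol k)%R.
Proof. by rewrite exprn_gt0// exprz_gt0. Qed.

Lemma measure_dyadic_cube k m : mu (dyadic_cube k m) = (dyadic_vol k)%:E.
Proof.
rewrite dyadic_cubeE /lebesgue_Rn/= /completed_measure_extension.
rewrite measurable_mu_extE; last exact: measurable_dyadic_box.
rewrite /= power_measure_box; last by move=> i; exact: measurable_itv.
rewrite (eq_bigr (fun=> (2 ^ (- k))%:E)); last first.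
  move=> i _; transitivity (@lebesgue_measure R (dyadic_side k m i)) => //.
  rewrite /dyadic_side lebesgue_measure_itv/= lte_fin.
  rewrite ltr_pM2l ?exprz_gt0// ltrDl ltr01 -EFinB; congr EFin; ring.
rewrite prodEFin; congr EFin.
by rewrite prodr_const card_ord.
Qed.

(** The index of the cube of generation [k] containing [x]. *)
Definition dyadic_index k x (i : 'I_n) : int :=
  Num.floor (2 ^ k * tnth (x : n.-tuple R) i)%R.

Lemma dyadic_cubeP k m x : dyadic_cube k m x <-> dyadic_index k x = m.
Proof.
have p0 : (0 < 2 ^ k :> R)%R by rewrite exprz_gt0.
have e i : (2 ^ (- k) * (m i)%:~R <= tnth (x : n.-tuple R) i < 2 ^ (- k) * ((m i)%:~R + 1))%R =
  (Num.floor (2 ^ k * tnth (x : n.-tuple R) i) == m i)%R.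
  rewrite -invr_expz ler_pdivrMl// ltr_pdivlMl//.
  by rewrite floor_eq intrD.
split.
  by move=> h; apply/funext => i; apply/eqP; exact: (etrans (esym (e i)) (h i)).
by move=> h i; apply: (etrans (e i)); rewrite -h; exact: eqxx.
Qed.

(** The index of the cube one generation coarser containing the cube of index [m]. *)
Definition dyadic_parent m (i : 'I_n) : int := (m i %/ 2)%Z.

(** The 2^n children are indexed by the corner [e] of the cube that they touch. *)
Definition dyadic_child m (e : {ffun 'I_n -> bool}) (i : 'I_n) : int :=
  (m i * 2 + (e i)%:Z)%R.

Lemma dyadic_childK m e : dyadic_parent (dyadic_child m e) = m.
Proof.
apply/funext => i; rewrite /dyadic_parent /dyadic_child divzMDl//.
by case: (e i); rewrite divz_small ?addr0.
Qed.

Lemma dyadic_child_inj m : injective (dyadic_child m).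
Proof.
move=> e1 e2 /funeqP h; apply/ffunP => i; have := h i.
by move/addrI; case: (e1 i); case: (e2 i).
Qed.

Lemma dyadic_childP m m' : dyadic_parent m' = m -> exists e, m' = dyadic_child m e.
Proof.
move=> <-; exists [ffun i => (m' i %% 2)%Z == 1%R].
apply/funext => i; rewrite /dyadic_child /dyadic_parent ffunE.
rewrite {1}(divz_eq (m' i) 2); congr (_ + _)%R.
have := modz_ge0 (m' i) (isT : 2 != 0 :> int)%R.
have := ltz_mod (m' i) (isT : 2 != 0 :> int)%R.
by case: (_ %% _)%Z => [[|[|]]|].
Qed.

Lemma dyadic_index_parent k x :
  dyadic_parent (dyadic_index (k + 1) x) = dyadic_index k x.
Proof.
apply/funext => i; rewrite /dyadic_parent /dyadic_index.
set y := (2 ^ k * tnth (x : n.-tuple R) i)%R.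
have -> : (2 ^ (k + 1) * tnth (x : n.-tuple R) i = 2 * y)%R.
  by rewrite expfzDr// expr1z /y; ring.
apply/esym/floor_def; set z := Num.floor (2 * y)%R.
have /andP[h1 h2] := floor_itv (2 * y)%R; rewrite -/z in h1 h2.
have zE := divz_eq z 2.
have m0 := modz_ge0 z (isT : 2 != 0 :> int)%R.
have m2 : ((z %% 2)%Z <= 1)%R.
  by have := ltz_mod z (isT : 2 != 0 :> int)%R; case: (_ %% _)%Z => [[|[|]]|].
move: h1 h2 m0 m2; rewrite {1 2}zE.
rewrite -(ler0z R) -(lerz1 R) !intrD !intrM.
set d := ((z %/ 2)%Z%:~R : R)%R; set r := ((z %% 2)%Z%:~R : R)%R.
move=> h1 h2 r0 r1; apply/andP; split; lra.
Qed.

Lemma dyadic_index_coarser k (j : nat) x y :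
  dyadic_index k x = dyadic_index k y ->
  dyadic_index (k - j%:Z) x = dyadic_index (k - j%:Z) y.
Proof.
move=> xy; elim: j => [|j IH]; first by rewrite subr0.
have e : (k - j%:Z = k - j.+1%:Z + 1)%R by rewrite -addn1 PoszD; ring.
by rewrite -!(dyadic_index_parent (k - j.+1%:Z)) -e IH.
Qed.

Lemma dyadic_cube_children k m :
  dyadic_cube k m = \big[setU/set0]_(e : {ffun 'I_n -> bool})
    (dyadic_cube (k + 1) (dyadic_child m e) : set (Rn R n)).
Proof.
apply/seteqP; split => x.
  move=> /dyadic_cubeP xm; rewrite -bigcup_seq/=.
  have [e he] := dyadic_childP m _ (etrans (dyadic_index_parent k x) xm).
  by exists e; [rewrite /= mem_index_enum|apply/dyadic_cubeP].
rewrite -bigcup_seq/= => -[e _ /dyadic_cubeP h]; apply/dyadic_cubeP.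
by rewrite -dyadic_index_parent h dyadic_childK.
Qed.

Lemma dyadic_child_sub k m e :
  (dyadic_cube (k + 1) (dyadic_child m e) : set (Rn R n)) `<=` dyadic_cube k m.
Proof.
by move=> x /dyadic_cubeP xe; apply/dyadic_cubeP; rewrite -dyadic_index_parent xe dyadic_childK.
Qed.

Lemma dyadic_vol_children k :
  dyadic_vol k = (#|{ffun 'I_n -> bool}|%:R * dyadic_vol (k + 1))%R.
Proof.
rewrite card_ffun card_bool card_ord natrX /dyadic_vol -exprMn.
by rewrite opprD expfzDr// mulrCA exprN1 mulfV ?mulr1// pnatr_eq0.
Qed.

Lemma integral_dyadic_children k m (h : Rn R n -> \bar R) :
  measurable_fun setT h -> (forall x, 0 <= h x) ->
  \int[mu]_(x in dyadic_cube k m) h x =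
  \sum_(e : {ffun 'I_n -> bool})
     \int[mu]_(x in dyadic_cube (k + 1) (dyadic_child m e)) h x.
Proof.
move=> mh h0; rewrite dyadic_cube_children ge0_integral_bigsetU//.
- by move=> e; exact: measurable_dyadic_cube.
- exact: index_enum_uniq.
- move=> e1 e2 _ _ [x [/dyadic_cubeP h1 /dyadic_cubeP h2]].
  by apply: (@dyadic_child_inj m); rewrite -h1.
- exact: measurable_funTS.
Qed.

End dyadic_cubes.

(** * Averages of extended nonnegative functions *)

Lemma lee_poweR {R : realType} (r : R) (x y : \bar R) :
  (0 <= r)%R -> 0 <= x -> x <= y -> x `^ r <= y `^ r.
Proof.
move=> r0 x0 xy; apply: gt0_ler_poweR => //; rewrite in_itv/= leey andbT//.
exact: le_trans xy.
Qed.

Lemma poweRK {R : realType} (r : R) (x : \bar R) :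
  r != 0%R -> 0 <= x -> (x `^ r) `^ r^-1 = x.
Proof. by move=> r0 x0; rewrite -poweRrM mulfV// poweRe1. Qed.

Lemma poweRVK {R : realType} (r : R) (x : \bar R) :
  r != 0%R -> 0 <= x -> (x `^ r^-1) `^ r = x.
Proof. by move=> r0 x0; rewrite -poweRrM mulVf// poweRe1. Qed.

Lemma weighted_amgme {R : realType} (tau X Y : R) (x y : \bar R) :
  (0 < tau < 1)%R -> (0 < X)%R -> (0 < Y)%R -> 0 <= x -> 0 <= y ->
  x `^ tau * y `^ (1 - tau) <=
  (X `^ tau * Y `^ (1 - tau))%:E *
    ((tau / X)%:E * x + ((1 - tau) / Y)%:E * y).
Proof.
move=> /[dup] ht /andP[t0 t1] X0 Y0.
have c0 : (0 < X `^ tau * Y `^ (1 - tau))%R by rewrite mulr_gt0 ?powR_gt0.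
have a0 : (0 < tau / X)%R by rewrite divr_gt0.
have b0 : (0 < (1 - tau) / Y)%R by rewrite divr_gt0// subr_gt0.
case: x => [x||]// x0; case: y => [y||]// y0; last first.
- by rewrite !gt0_muley ?lte_fin// leey.
- by rewrite gt0_muley ?lte_fin// addye// gt0_muley ?lte_fin// leey.
- by rewrite [X in _ + X]gt0_muley ?lte_fin// addey// gt0_muley ?lte_fin// leey.
rewrite !poweR_EFin -!EFinM lee_fin.
have -> : (tau / X * x + (1 - tau) / Y * y =
           tau * (x / X) + (1 - tau) * (y / Y))%R by ring.
exact: weighted_amgm_normalized.
Qed.

Section average.
Context {d} {T : measurableType d} {R : realType}.
Variable mu : {measure set T -> \bar R}.
Variables (Q : set T) (V : R).
Hypotheses (mQ : measurable Q) (V0 : (0 < V)%R) (muQ : mu Q = V%:E).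
Implicit Types (f g : T -> \bar R) (w : T -> R).

(** The average over [Q]; it coincides by computation with the one in [Lavg]. *)
Definition average (h : T -> \bar R) : \bar R := (mu Q)^-1 * \int[mu]_(x in Q) h x.

Lemma averageE h : average h = (V^-1)%:E * \int[mu]_(x in Q) h x.
Proof. by rewrite /average muQ inver gt_eqF. Qed.

Lemma average_ge0 f : (forall x, 0 <= f x) -> 0 <= average f.
Proof.
move=> f0; rewrite averageE mule_ge0//; first by rewrite lee_fin invr_ge0 ltW.
by apply: integral_ge0 => x _.
Qed.

Lemma integral_average f : \int[mu]_(x in Q) f x = V%:E * average f.
Proof. by rewrite averageE muleA -EFinM mulfV ?gt_eqF// mul1e. Qed.

Lemma le_average f g : measurable_fun setT f -> measurable_fun setT g ->
  (forall x, 0 <= f x) -> (forall x, Q x -> f x <= g x) -> average f <= average g.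
Proof.
move=> mf mg f0 fg; rewrite !averageE lee_wpmul2l ?lee_fin ?invr_ge0 ?(ltW V0)//.
by apply: ge0_le_integral => //; exact: measurable_funTS.
Qed.

Lemma ae_le_average f g : measurable_fun setT f -> measurable_fun setT g ->
  (forall x, 0 <= f x) -> (forall x, 0 <= g x) ->
  {ae mu, forall x, Q x -> f x <= g x} -> average f <= average g.
Proof.
move=> mf mg f0 g0 fg; rewrite !averageE lee_wpmul2l ?lee_fin ?invr_ge0 ?(ltW V0)//.
by apply: ae_ge0_le_integral => //; exact: measurable_funTS.
Qed.

Lemma averageZ (k : R) f : measurable_fun setT f -> (forall x, 0 <= f x) ->
  (0 <= k)%R -> average (fun x => k%:E * f x) = k%:E * average f.
Proof.
move=> mf f0 k0; rewrite !averageE ge0_integralZl_EFin//; first by rewrite muleCA.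
exact: measurable_funTS.
Qed.

Lemma averageD f g : measurable_fun setT f -> measurable_fun setT g ->
  (forall x, 0 <= f x) -> (forall x, 0 <= g x) ->
  average (fun x => f x + g x) = average f + average g.
Proof.
move=> mf mg f0 g0; rewrite !averageE ge0_integralD//; [|exact: measurable_funTS..].
by rewrite ge0_muleDr//; apply: integral_ge0.
Qed.

Lemma average_cst (k : R) : average (cst k%:E) = k%:E.
Proof.
by rewrite averageE integral_cst// muQ -!EFinM mulrCA mulVf ?mulr1// gt_eqF.
Qed.

Lemma average_eq0 f : measurable_fun setT f -> (forall x, 0 <= f x) ->
  average f = 0 -> {ae mu, forall x, Q x -> f x = 0}.
Proof.
move=> mf f0; rewrite averageE => /eqP.
rewrite mule_eq0 eqe invr_eq0 gt_eqF//= => /eqP h.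
apply/(ae_eq_integral_abs mu mQ (measurable_funTS mf)).
by rewrite -[RHS]h; apply: eq_integral => x _; rewrite gee0_abs.
Qed.

Lemma average_fin_ae f : measurable_fun setT f -> (forall x, 0 <= f x) ->
  average f < +oo -> {ae mu, forall x, Q x -> f x \is a fin_num}.
Proof.
move=> mf f0 h; apply: integrable_ae => //; apply/integrableP; split.
  exact: measurable_funTS.
have -> : \int[mu]_(x in Q) `|f x| = \int[mu]_(x in Q) f x.
  by apply: eq_integral => x _; rewrite gee0_abs.
by rewrite integral_average lte_mul_pinfty ?lee_fin ?(ltW V0)//.
Qed.

Lemma average_ae0 f : measurable_fun setT f -> (forall x, 0 <= f x) ->
  {ae mu, forall x, Q x -> f x = 0} -> average f = 0.
Proof.
move=> mf f0 h; apply/le_anti; rewrite average_ge0// andbT -[leRHS](average_cst 0).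
by apply: ae_le_average => //; apply: filterS h => x /[apply] ->.
Qed.

Lemma measurable_poweR_comp f (r : R) : measurable_fun setT f ->
  measurable_fun setT (fun x => f x `^ r).
Proof. by move=> mf; exact: (measurableT_comp (measurable_poweR r)). Qed.

(** Holder's inequality, with values in [0, oo]. *)
Lemma average_holder f g (tau : R) : (0 < tau < 1)%R ->
  measurable_fun setT f -> measurable_fun setT g ->
  (forall x, 0 <= f x) -> (forall x, 0 <= g x) ->
  average (fun x => f x `^ tau * g x `^ (1 - tau)) <=
  average f `^ tau * average g `^ (1 - tau).
Proof.
move=> /[dup] ht /andP[t0 t1] mf mg f0 g0.
have u0 : (0 < 1 - tau)%R by rewrite subr_gt0.
have mfg : measurable_fun setT (fun x => f x `^ tau * g x `^ (1 - tau)).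
  by apply: emeasurable_funM; exact: measurable_poweR_comp.
have fg0 x : 0 <= f x `^ tau * g x `^ (1 - tau) by rewrite mule_ge0 ?poweR_ge0.
have [h|fn0] := eqVneq (average f) 0.
  rewrite average_ae0 ?mule_ge0 ?poweR_ge0//.
  by apply: filterS (average_eq0 f mf f0 h) => x /[apply] ->; rewrite poweR0r ?gt_eqF// mul0e.
have [h|gn0] := eqVneq (average g) 0.
  rewrite average_ae0 ?mule_ge0 ?poweR_ge0//.
  by apply: filterS (average_eq0 g mg g0 h) => x /[apply] ->; rewrite poweR0r ?gt_eqF// mule0.
have {}fn0 : 0 < average f by rewrite lt_def fn0 average_ge0.
have {}gn0 : 0 < average g by rewrite lt_def gn0 average_ge0.
have [h|fy] := eqVneq (average f) +oo.
  by rewrite h poweRyr ?gt_eqF// gt0_mulye ?poweR_gt0// leey.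
have [h|gy] := eqVneq (average g) +oo.
  by rewrite h poweRyr ?gt_eqF// gt0_muley ?poweR_gt0// leey.
have [X X0 fX] : exists2 X, (0 < X)%R & average f = X%:E.
  exists (fine (average f)); last by rewrite fineK// ge0_fin_numE ?ltey// ltW.
  by rewrite fine_gt0// fn0 ltey.
have [Y Y0 gY] : exists2 Y, (0 < Y)%R & average g = Y%:E.
  exists (fine (average g)); last by rewrite fineK// ge0_fin_numE ?ltey// ltW.
  by rewrite fine_gt0// gn0 ltey.
have a0 : (0 <= tau / X)%R by rewrite divr_ge0// ltW.
have b0 : (0 <= (1 - tau) / Y)%R by rewrite divr_ge0// ltW.
pose h x := (X `^ tau * Y `^ (1 - tau))%:E * ((tau / X)%:E * f x + ((1 - tau) / Y)%:E * g x).
have m1 : measurable_fun setT (fun x => (tau / X)%:E * f x) by exact: measurable_funeM.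
have m2 : measurable_fun setT (fun x => ((1 - tau) / Y)%:E * g x) by exact: measurable_funeM.
have m3 : measurable_fun setT (fun x => (tau / X)%:E * f x + ((1 - tau) / Y)%:E * g x).
  exact: emeasurable_funD.
apply: (@le_trans _ _ (average h)).
  apply: le_average => //; first exact: measurable_funeM.
  by move=> x _; exact: weighted_amgme.
have f0' x : 0 <= (tau / X)%:E * f x by rewrite mule_ge0.
have g0' x : 0 <= ((1 - tau) / Y)%:E * g x by rewrite mule_ge0.
rewrite /h averageZ//; last 2 first.
- by move=> x; rewrite adde_ge0.
- by rewrite mulr_ge0 ?powR_ge0.
rewrite averageD// !averageZ// fX gY !poweR_EFin -!EFinM.
by rewrite !divfK ?gt_eqF// (addrC tau) subrK mulr1.
Qed.

(** The power mean [(average (|h| ^ u)) ^ (1 / u)]. *)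
Definition pmean (u : R) (h : T -> \bar R) : \bar R :=
  average (fun x => `|h x| `^ u) `^ u^-1.

Lemma pmean_ge0 u h : 0 <= pmean u h.
Proof. exact: poweR_ge0. Qed.

Lemma measurable_abse_poweR f (r : R) : measurable_fun setT f ->
  measurable_fun setT (fun x => `|f x| `^ r).
Proof. by move=> mf; apply: measurable_poweR_comp; exact: measurableT_comp. Qed.

Lemma le_pmean u u' f : (0 < u)%R -> (u < u')%R -> measurable_fun setT f ->
  pmean u f <= pmean u' f.
Proof.
move=> u0 uu' mf; have u'0 : (0 < u')%R by exact: lt_trans uu'.
have ht : (0 < u / u' < 1)%R by rewrite divr_gt0//= ltr_pdivrMr// mul1r.
have := average_holder _ _ _ ht (measurable_abse_poweR f u' mf)
  (measurable_cst 1) (fun x => poweR_ge0 _ _) (fun x => lee01).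
rewrite (average_cst 1) [X in _ <= _ * X -> _]poweR1r mule1.
rewrite [X in average X](_ : _ = (fun x => `|f x| `^ u)); last first.
  apply/funext => x; rewrite [X in _ * X]poweR1r mule1 -poweRrM.
  by rewrite [(u' * _)%R]mulrCA mulfV ?gt_eqF// mulr1.
move=> h.
have -> : pmean u' f = (average (fun x => `|f x| `^ u') `^ (u / u')) `^ u^-1.
  by rewrite -poweRrM mulrAC mulfV ?gt_eqF// mul1r.
apply: lee_poweR => //; first by rewrite invr_ge0 ltW.
by apply: average_ge0 => x; rewrite poweR_ge0.
Qed.

Lemma measurable_inv_weight w : (forall x, 0 <= w x)%R -> measurable_fun setT w ->
  measurable_fun setT (fun x => (w x)%:E^-1).
Proof.
move=> w0 mw.
rewrite (_ : (fun _ => _) = (fun x => if w x == 0%R then +oo else (w x `^ (- 1))%:E)).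
  apply: measurable_fun_ifT => //; first exact: measurable_fun_eqr.
  apply/measurable_EFinP; exact: (measurableT_comp (measurable_powR (-1))).
by apply/funext => x; rewrite inver powR_inv1.
Qed.

Lemma pmean_inv_gt0 e w : (0 < e)%R -> (forall x, 0 <= w x)%R ->
  measurable_fun setT w -> 0 < pmean e (fun x => (w x)%:E^-1).
Proof.
move=> e0 w0 mw; rewrite lt_def pmean_ge0 andbT; apply/eqP => h.
have h0 x : 0 < `|(w x)%:E^-1| `^ e.
  apply: poweR_gt0; rewrite inver; case: ifPn => // wx.
  by rewrite abse_EFin lte_fin normr_gt0 invr_eq0.
have mf := measurable_abse_poweR _ e (measurable_inv_weight w w0 mw).
have /(average_eq0 _ mf (fun x => ltW (h0 x))) : average (fun x => `|(w x)%:E^-1| `^ e) = 0.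
  by apply: poweR_eq0_eq0 h; apply: average_ge0 => x; exact: ltW.
move=> [N [mN muN sub]].
have : mu Q <= mu N.
  apply: le_measure; rewrite ?inE// => x Qx; apply: sub => /= /(_ Qx) hx.
  by have := h0 x; rewrite hx ltxx.
by rewrite muN muQ lee_fin leNgt V0.
Qed.

Lemma pmean_inv_fin_ae e w : (0 < e)%R -> (forall x, 0 <= w x)%R ->
  measurable_fun setT w -> pmean e (fun x => (w x)%:E^-1) < +oo ->
  {ae mu, forall x, Q x -> (0 < w x)%R}.
Proof.
move=> e0 w0 mw h.
have mf := measurable_abse_poweR _ e (measurable_inv_weight w w0 mw).
have : average (fun x => `|(w x)%:E^-1| `^ e) < +oo.
  by apply: lty_poweRy h; rewrite gt_eqF// invr_gt0.
move=> /(average_fin_ae _ mf (fun x => poweR_ge0 _ _)).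
apply: filterS => x /[apply]; rewrite inver; case: ifPn => [_|wx _].
  by rewrite poweRyr// gt_eqF.
by rewrite lt_def wx w0.
Qed.

(** Holder's inequality for f = (|f| w) (1/w). *)
Lemma pmean_weight_holder u b e f w : (0 < b)%R -> (0 < e)%R ->
  (u^-1 = b^-1 + e^-1)%R ->
  measurable_fun setT f -> measurable_fun setT w -> (forall x, 0 <= w x)%R ->
  {ae mu, forall x, Q x -> (0 < w x)%R} ->
  pmean u f <= pmean b (fun x => `|f x| * (w x)%:E) * pmean e (fun x => (w x)%:E^-1).
Proof.
move=> b0 e0 ube mf mw w0 wae.
have u0 : (0 < u)%R by rewrite -invr_gt0 ube addr_gt0 ?invr_gt0.
have ht : (0 < u / b < 1)%R.
  rewrite divr_gt0//= ltr_pdivrMr// mul1r -ltf_pV2 ?posrE// ube ltrDl invr_gt0//.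
have t1 : (1 - u / b = u / e)%R.
  have := congr1 (fun z => (u * z)%R) ube; rewrite mulfV ?gt_eqF// => ->.
  by rewrite mulrDr addrC addKr.
pose F x := `| `|f x| * (w x)%:E| `^ b; pose G x := `|(w x)%:E^-1| `^ e.
have mF : measurable_fun setT F.
  apply: measurable_abse_poweR; apply: emeasurable_funM.
    exact: measurableT_comp.
  exact/measurable_EFinP.
have mG : measurable_fun setT G.
  by apply: measurable_abse_poweR; exact: measurable_inv_weight.
have h := average_holder F G _ ht mF mG (fun x => poweR_ge0 _ _) (fun x => poweR_ge0 _ _).
have -> : pmean b (fun x => `|f x| * (w x)%:E) * pmean e (fun x => (w x)%:E^-1) =
  (average F `^ (u / b) * average G `^ (1 - u / b)) `^ u^-1.
  rewrite poweRM ?poweR_ge0// -!poweRrM t1.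
  by rewrite mulrAC mulfV ?gt_eqF// mul1r mulrAC mulfV ?gt_eqF// mul1r.
apply: lee_poweR; first by rewrite invr_ge0 ltW.
  by apply: average_ge0 => x; rewrite poweR_ge0.
apply: le_trans h; apply: ae_le_average.
- exact: measurable_abse_poweR.
- by apply: emeasurable_funM; exact: measurable_poweR_comp.
- by move=> x; rewrite poweR_ge0.
- by move=> x; rewrite mule_ge0 ?poweR_ge0.
apply: filterS wae => x /[apply] wx.
rewrite /F /G t1 -!poweRrM [(b * _)%R]mulrCA [(e * _)%R]mulrCA !mulfV ?gt_eqF// mulr1.
rewrite -poweRM ?abse_ge0// -abseM -muleA inver gt_eqF// -EFinM mulfV ?gt_eqF//.
by rewrite mule1 abse_id.
Qed.

End average.

(** * Suprema over dyadic cubes *)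

Section cube_functions.
Context {R : realType} {n : nat}.
Local Notation mu := (lebesgue_Rn R n).
Variable c : int -> ('I_n -> int) -> \bar R.
Implicit Types (k : int) (m : 'I_n -> int) (x : Rn R n).

(** The value of [c] on the cube of generation [k] containing a point. *)
Definition cube_value k x : \bar R := c k (dyadic_index k x).

Lemma measurable_cube_value k : measurable_fun setT (cube_value k).
Proof.
move=> _ Y mY; rewrite setTI.
rewrite (_ : _ @^-1` _ = \bigcup_(m : {ffun 'I_n -> int})
    if `[< Y (c k m) >] then dyadic_cube k m else set0); last first.
  apply/seteqP; split => x /=.
    move=> Yx; exists (finfun (dyadic_index k x)) => //.
    have e : (finfun (dyadic_index k x) : {ffun 'I_n -> int}) = dyadic_index k x :> (_ -> _).
      by apply/funext => i; rewrite ffunE.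
    by rewrite e asboolT//; apply/dyadic_cubeP.
  by move=> [m _]; case: asboolP => // Ym /dyadic_cubeP; rewrite /cube_value => ->.
apply: countable_bigcupT_measurable => [|m]; first exact: countableP.
by case: ifP => // _; exact: measurable_dyadic_cube.
Qed.

Lemma measurable_dyadic_sup :
  measurable_fun setT (fun x => ereal_sup (range (fun k => cube_value k x))).
Proof.
move=> _; apply: (measurability _ (ErealGenOInfty.measurableE R)) => //.
move=> _ [_ [y ->] <-]; rewrite setTI.
rewrite (_ : _ @^-1` _ = \bigcup_k [set x | y%:E < cube_value k x]); last first.
  apply/seteqP; split => x /=; rewrite in_itv/= andbT.
    by move=> /ereal_sup_gt[_ [k _ <-] yk]; exists k.
  move=> [k _ /= yk]; apply: (lt_le_trans yk).
  by apply: ereal_sup_ubound; exists k.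
apply: countable_bigcupT_measurable => [|k]; first exact: countableP.
rewrite -[X in measurable X]setTI.
apply: emeasurable_fun_o_infty; [exact: measurableT|exact: measurable_cube_value].
Qed.

(** The maximum of [b] and of the values of [c] on the cubes of generations
    [k], ..., [k + N - 1] containing [x]. *)
Fixpoint cube_max (N : nat) k x (b : \bar R) : \bar R :=
  if N is N'.+1 then cube_max N' (k + 1) x (maxe b (cube_value k x)) else b.

Lemma cube_max_homo N k x : {homo cube_max N k x : b b' / b <= b'}.
Proof.
elim: N k => [|N IH] k b b' bb' //=; apply: IH.
by rewrite ge_max !le_max bb' lexx orbT.
Qed.

Lemma le_cube_max N k x b : b <= cube_max N k x b.
Proof.
elim: N k b => [|N IH] k b //=; apply: le_trans (IH _ _).
by rewrite le_max lexx.
Qed.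

Lemma cube_max_ge N k x b (j : nat) : (j < N)%N ->
  cube_value (k + j%:Z) x <= cube_max N k x b.
Proof.
elim: N k b j => [//|N IH] k b [|j] jN /=.
  by apply: le_trans (le_cube_max _ _ _ _); rewrite addr0 le_max lexx orbT.
by rewrite (_ : (k + j.+1%:Z = k + 1 + j%:Z)%R); [exact: IH|rewrite -addn1 PoszD; ring].
Qed.

Lemma cube_max_nd k x b : {homo (fun N => cube_max N k x b) : N N' / (N <= N')%N >-> N <= N'}.
Proof.
apply: homo_leq => [//|y z t|N]; first exact: le_trans.
elim: N k b => [|N IH] k b; first exact: le_cube_max.
exact: IH.
Qed.

Lemma measurable_cube_max N k (b : Rn R n -> \bar R) : measurable_fun setT b ->
  measurable_fun setT (fun x => cube_max N k x (b x)).
Proof.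
elim: N k b => [|N IH] k b mb /=; first exact: mb.
apply: (IH (k + 1)%R (fun x => maxe (b x) (cube_value k x))).
by apply: measurable_maxe; [exact: mb|exact: measurable_cube_value].
Qed.

(** Over the subcubes of [Q0], [c = P ^ kappa] with [P] a supermartingale, and the
    average [h] of [nu] times [c] is dominated by [f1 ^ a] and [f2 ^ a] for two
    martingales [f1], [f2]; [F1] and [F2] are the averages of the [a]-th powers of
    the functions with averages [f1] and [f2]. *)
Section bellman_induction.
Variables (nu : Rn R n -> \bar R) (Q0 : set (Rn R n)).
Variables (P h f1 F1 f2 F2 : int -> ('I_n -> int) -> R) (kappa a c1 c2 : R).
Local Notation sub k m := ((dyadic_cube k m : set (Rn R n)) `<=` Q0).
Local Notation child_average f k m :=
  (\sum_(e : {ffun 'I_n -> bool}) #|{ffun 'I_n -> bool}|%:R^-1 *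
     f (k + 1)%R (dyadic_child m e))%R.
Hypotheses (kappa0 : (0 < kappa)%R) (a1 : (1 < a)%R).
Hypotheses (c10 : (0 <= c1)%R) (c20 : (0 <= c2)%R).
Hypotheses (mnu : measurable_fun setT nu) (nu0 : forall x, 0 <= nu x).
Hypothesis cP : forall k m, sub k m -> c k m = (P k m `^ kappa)%:E.
Hypothesis P0 : forall k m, (0 <= P k m)%R.
Hypothesis superP : forall k m, sub k m -> (child_average P k m <= P k m)%R.
Hypothesis hnu : forall k m, sub k m ->
  \int[mu]_(x in dyadic_cube k m) nu x = (dyadic_vol (R:=R) (n:=n) k * h k m)%:E.
Hypothesis h0 : forall k m, (0 <= h k m)%R.
Hypotheses (f10 : forall k m, (0 <= f1 k m)%R) (f20 : forall k m, (0 <= f2 k m)%R).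
Hypothesis f1F1 : forall k m, sub k m -> (f1 k m `^ a <= F1 k m)%R.
Hypothesis f2F2 : forall k m, sub k m -> (f2 k m `^ a <= F2 k m)%R.
Hypothesis mart_f1 : forall k m, sub k m -> f1 k m = child_average f1 k m.
Hypothesis mart_F1 : forall k m, sub k m -> F1 k m = child_average F1 k m.
Hypothesis mart_f2 : forall k m, sub k m -> f2 k m = child_average f2 k m.
Hypothesis mart_F2 : forall k m, sub k m -> F2 k m = child_average F2 k m.
Hypothesis key : forall k m, sub k m ->
  (P k m `^ kappa * h k m <= c1 * f1 k m `^ a + c2 * f2 k m `^ a)%R.

Let bound k m rho : R :=
  ((2 * rho) `^ kappa * h k m + bellman_const kappa a *
    (c1 * bellman a (P k m) rho (f1 k m) (F1 k m) +
     c2 * bellman a (P k m) rho (f2 k m) (F2 k m)))%R.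

Let C0 : (0 <= bellman_const kappa a)%R := bellman_const_ge0 _ _ a1.

Let sub_child k m e : sub k m -> sub (k + 1)%R (dyadic_child m e).
Proof.
by move=> km; exact: (subset_trans (dyadic_child_sub k m e) km).
Qed.

Let p : R := (#|{ffun 'I_n -> bool}|%:R^-1)%R.

Let card_gt0 : (0 < #|{ffun 'I_n -> bool}|%:R :> R)%R.
Proof. by rewrite ltr0n; apply/card_gt0P; exists [ffun=> true]. Qed.

Let p0 : (0 <= p)%R. Proof. by rewrite invr_ge0 ltW. Qed.

Let sum_p : (\sum_(e : {ffun 'I_n -> bool}) p = 1)%R.
Proof. by rewrite sumr_const -mulr_natr mulVf// gt_eqF. Qed.

Let hE k m : sub k m -> h k m = child_average h k m.
Proof.
move=> km; have := hnu k m km.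
rewrite integral_dyadic_children//.
rewrite (eq_bigr (fun e => (dyadic_vol (R:=R) (n:=n) (k + 1) *
  h (k + 1)%R (dyadic_child m e))%:E)); last by move=> e _; rewrite hnu//; exact: sub_child.
rewrite sumEFin => -[]; rewrite -mulr_sumr (dyadic_vol_children k).
rewrite [X in _ = (X * _)%R]mulrC -mulrA.
move/(mulfI (negbT (gt_eqF (dyadic_vol_gt0 (k + 1))))) => e.
by rewrite -mulr_sumr e mulrA mulVf ?mul1r// gt_eqF.
Qed.

Let bound_children k m rho : sub k m -> (0 < rho)%R ->
  let jump := (2 * rho < P k m)%R in
  (\sum_e p * bound (k + 1)%R (dyadic_child m e) (if jump then P k m else rho)
   <= bound k m rho)%R.
Proof.
move=> km r0; cbv zeta; set jump := (2 * rho < P k m)%R.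
set rho' := (if jump then P k m else rho).
have st f F : (forall k m, (0 <= f k m)%R) -> f k m = child_average f k m ->
    F k m = child_average F k m -> _ :=
  fun f0 fE FE => @bellman_step R _ (fun=> p)
    (fun e => P (k + 1)%R (dyadic_child m e))
    (fun e => f (k + 1)%R (dyadic_child m e)) (fun e => F (k + 1)%R (dyadic_child m e))
    (P k m) rho (f k m) (F k m) a a1 (fun=> p0) sum_p r0 (fun e => P0 _ _)
    (superP _ _ km) (fun e => f0 _ _) fE FE.
have := st f1 F1 f10 (mart_f1 _ _ km) (mart_F1 _ _ km).
have := st f2 F2 f20 (mart_f2 _ _ km) (mart_F2 _ _ km).
cbv zeta; rewrite -/jump -/rho'.
set S1 := (\sum_e _)%R; set S2 := (\sum_e _)%R => h1 h2.
have -> : (\sum_e p * bound (k + 1)%R (dyadic_child m e) rho' =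
    (2 * rho') `^ kappa * child_average h k m +
    bellman_const kappa a * (c1 * S2 + c2 * S1))%R.
  rewrite /S1 /S2 !mulr_sumr -big_split/= mulr_sumr -big_split/=.
  by apply: eq_bigr => e _; rewrite -/p /bound; ring.
rewrite -hE// /bound.
set B1 := bellman _ _ _ _ _ in h2 *; set B2 := bellman _ _ _ _ _ in h1 *.
have g1 := ler_wpM2l c10 h2; have g2 := ler_wpM2l c20 h1.
have g := ler_wpM2l C0 (lerD g1 g2).
apply: le_trans (lerD (lexx _) g).
suff : ((2 * rho') `^ kappa * h k m <= (2 * rho) `^ kappa * h k m +
  jump%:R * (bellman_const kappa a * ((a - 1) / 3 `^ a) *
    (c1 * f1 k m `^ a + c2 * f2 k m `^ a)))%R by lra.
have -> : (bellman_const kappa a * ((a - 1) / 3 `^ a) = 2 `^ kappa)%R.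
  rewrite /bellman_const; field; rewrite gt_eqF ?powR_gt0//= subr_eq0 gt_eqF//.
rewrite /rho' /jump; case: (ltP (2 * rho)%R) => hj; last by rewrite mul0r addr0.
rewrite mul1r powRM// -mulrA; apply: ler_wpDl; first by rewrite mulr_ge0 ?powR_ge0.
by rewrite ler_wpM2l ?powR_ge0// key.
Qed.

Let bound_ge k m rho : sub k m -> (0 < rho)%R ->
  ((2 * rho) `^ kappa * h k m <= bound k m rho)%R.
Proof.
by move=> km r0; rewrite lerDl mulr_ge0// addr_ge0// mulr_ge0// bellman_ge0// ?f1F1 ?f2F2.
Qed.

(** The induction on the number of generations; [bound_children] is its step, and
    [(2 * rho) ^ kappa] is the level below which values of [c] are ignored. *)
Lemma integral_cube_max_le N k m rho : sub k m -> (0 < rho)%R ->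
  \int[mu]_(x in dyadic_cube k m) (cube_max N k x ((2 * rho) `^ kappa)%:E * nu x)
  <= (dyadic_vol (R:=R) (n:=n) k * bound k m rho)%:E.
Proof.
elim: N k m rho => [|N IH] k m rho km r0.
  rewrite /= ge0_integralZl_EFin ?powR_ge0//; last 2 first.
  - exact: measurable_dyadic_cube.
  - exact: measurable_funTS.
  by rewrite hnu// -EFinM lee_fin mulrCA ler_wpM2l ?bound_ge// ltW// dyadic_vol_gt0.
set rho' := (if (2 * rho < P k m)%R then P k m else rho).
have r0' : (0 < rho')%R.
  by rewrite /rho'; case: (ltP (2 * rho)%R) => // /(lt_trans _)-> //; rewrite mulr_gt0.
pose g x := cube_max N (k + 1) x ((2 * rho') `^ kappa)%:E * nu x.
have mg : measurable_fun setT g.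
  apply: emeasurable_funM; last exact: mnu.
  apply: (measurable_cube_max N (k + 1)%R (fun=> ((2 * rho') `^ kappa)%:E)).
  exact: measurable_cst.
have b0 r : 0 <= ((2 * r) `^ kappa)%:E by rewrite lee_fin powR_ge0.
have g0 x : 0 <= g x.
  by rewrite mule_ge0// (le_trans (b0 rho'))// le_cube_max.
apply: (@le_trans _ _ (\int[mu]_(x in dyadic_cube k m) g x)).
  apply: ge0_le_integral.
  - exact: measurable_dyadic_cube.
  - by move=> x _; rewrite mule_ge0// (le_trans (b0 rho))// (le_cube_max N.+1).
  - apply: measurable_funTS; apply: emeasurable_funM; last exact: mnu.
    apply: (measurable_cube_max N.+1 k (fun=> ((2 * rho) `^ kappa)%:E)).
    exact: measurable_cst.
  - exact: measurable_funTS.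
  move=> x /dyadic_cubeP xm; rewrite lee_wpmul2r//=; apply: cube_max_homo.
  rewrite /cube_value xm cP// ge_max !lee_fin /rho'.
  case: (ltP (2 * rho)%R) => hj.
    have PP := P0 k m.
    by rewrite !ge0_ler_powR ?nnegrE ?(ltW kappa0) ?mulr_ge0 ?(ltW r0)//; lra.
  by rewrite lexx/= ge0_ler_powR ?nnegrE ?(ltW kappa0) ?mulr_ge0 ?(ltW r0).
rewrite integral_dyadic_children//.
apply: (@le_trans _ _ (\sum_(e : {ffun 'I_n -> bool})
    (dyadic_vol (R:=R) (n:=n) (k + 1) * bound (k + 1)%R (dyadic_child m e) rho')%:E)).
  by apply: lee_sum => e _; apply: IH => //; exact: sub_child.
rewrite sumEFin lee_fin (dyadic_vol_children k).
have -> : (\sum_(e : {ffun 'I_n -> bool}) dyadic_vol (R:=R) (n:=n) (k + 1) *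
      bound (k + 1)%R (dyadic_child m e) rho' =
    #|{ffun 'I_n -> bool}|%:R * dyadic_vol (R:=R) (n:=n) (k + 1) *
     \sum_e p * bound (k + 1)%R (dyadic_child m e) rho')%R.
  by rewrite -!mulr_sumr mulrACA mulfV ?mul1r// gt_eqF.
rewrite ler_wpM2l ?mulr_ge0 ?(ltW card_gt0) ?(ltW (dyadic_vol_gt0 _))//.
exact: bound_children.
Qed.

(** The starting level [b] is any positive number. *)
Lemma integral_cube_max_le_level N k m (b : R) : sub k m -> (0 < b)%R ->
  \int[mu]_(x in dyadic_cube k m) (cube_max N k x b%:E * nu x)
  <= (dyadic_vol (R:=R) (n:=n) k * (b * h k m +
       bellman_const kappa a * (c1 * F1 k m + c2 * F2 k m)))%:E.
Proof.
move=> km b0.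
have r0 : (0 < b `^ kappa^-1 / 2)%R by rewrite divr_gt0// powR_gt0.
have := integral_cube_max_le N _ _ _ km r0.
rewrite /bound [(2 * _)%R]mulrC divfK// -powRrM mulVf ?gt_eqF// (powRr1 (ltW b0)).
move=> H; apply: le_trans H _.
rewrite lee_fin ler_wpM2l ?(ltW (dyadic_vol_gt0 _))// lerD2l ler_wpM2l//.
by apply: lerD; apply: ler_wpM2l => //; rewrite /bellman gerBl divr_ge0 ?powR_ge0.
Qed.

End bellman_induction.
End cube_functions.

(** * Averages over dyadic cubes *)

Section cube_averages.
Context {R : realType} {n : nat}.
Local Notation mu := (lebesgue_Rn R n).
Implicit Types (k : int) (m : 'I_n -> int) (h : Rn R n -> \bar R).

Definition cube_average h k m : \bar R := average mu (dyadic_cube k m) h.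

Local Notation cube k m := (dyadic_cube k m : set (Rn R n)).
Local Notation vol k := (dyadic_vol (R:=R) (n:=n) k).

Lemma cube_average_ge0 h k m : (forall x, 0 <= h x) -> 0 <= cube_average h k m.
Proof. exact: (average_ge0 mu _ _ (dyadic_vol_gt0 k) (measure_dyadic_cube k m)). Qed.

Lemma integral_cube_average h k m :
  \int[mu]_(x in cube k m) h x = (vol k)%:E * cube_average h k m.
Proof. exact: (integral_average mu _ _ (dyadic_vol_gt0 k) (measure_dyadic_cube k m)). Qed.

Lemma dyadic_vol_homo k m k' m' : cube k m `<=` cube k' m' -> (vol k <= vol k')%R.
Proof.
move=> sub; rewrite -lee_fin -!(@measure_dyadic_cube R n _ m) (measure_dyadic_cube k' m).
rewrite -(measure_dyadic_cube k' m'); apply: le_measure => //; rewrite inE;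
  exact: measurable_dyadic_cube.
Qed.

Section finite_averages.
Variables (h : Rn R n -> \bar R) (k0 : int) (m0 : 'I_n -> int).
Hypotheses (mh : measurable_fun setT h) (h0 : forall x, 0 <= h x).
Hypothesis fin0 : cube_average h k0 m0 < +oo.

Lemma integral_sub_cube k m : cube k m `<=` cube k0 m0 ->
  \int[mu]_(x in cube k m) h x <= \int[mu]_(x in cube k0 m0) h x.
Proof.
move=> sub; apply: ge0_subset_integral => //; [exact: measurable_dyadic_cube..|].
exact: measurable_funTS.
Qed.

Lemma cube_average_fin k m : cube k m `<=` cube k0 m0 ->
  cube_average h k m = (fine (cube_average h k m))%:E.
Proof.
move=> sub; rewrite fineK// ge0_fin_numE ?cube_average_ge0//.
have := integral_sub_cube _ _ sub; rewrite !integral_cube_average => le.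
have : (vol k)%:E * cube_average h k m < +oo.
  by apply: le_lt_trans le _; rewrite lte_mul_pinfty ?lee_fin// ltW// dyadic_vol_gt0.
apply: contraTT; rewrite -!leNgt !leye_eq => /eqP ->.
by rewrite gt0_muley// lte_fin dyadic_vol_gt0.
Qed.

Lemma cube_average_children k m : cube k m `<=` cube k0 m0 ->
  fine (cube_average h k m) = (\sum_(e : {ffun 'I_n -> bool})
    #|{ffun 'I_n -> bool}|%:R^-1 * fine (cube_average h (k + 1)%R (dyadic_child m e)))%R.
Proof.
move=> sub; have := integral_dyadic_children k m h mh h0.
rewrite integral_cube_average cube_average_fin//.
rewrite (eq_bigr (fun e => (vol (k + 1) *
    fine (cube_average h (k + 1)%R (dyadic_child m e)))%:E)); last first.
  move=> e _; rewrite integral_cube_average {1}cube_average_fin//.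
  by exact: (subset_trans (dyadic_child_sub k m e) sub).
rewrite sumEFin => -[]; rewrite -mulr_sumr (dyadic_vol_children k).
rewrite [X in (X * _)%R = _]mulrC -mulrA.
move/(mulfI (negbT (gt_eqF (dyadic_vol_gt0 (k + 1))))) => e.
rewrite -mulr_sumr -e mulrA mulVf ?mul1r//.
by rewrite pnatr_eq0 -lt0n; apply/card_gt0P; exists [ffun=> true].
Qed.

Lemma cube_average_sub_eq0 k m : cube k m `<=` cube k0 m0 ->
  cube_average h k0 m0 = 0 -> cube_average h k m = 0.
Proof.
move=> sub z; have := integral_sub_cube _ _ sub.
rewrite !integral_cube_average z mule0 => le.
have : (vol k)%:E * cube_average h k m == 0.
  by rewrite eq_le le mule_ge0// ?cube_average_ge0// lee_fin ltW// dyadic_vol_gt0.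
by rewrite mule_eq0 eqe gt_eqF ?dyadic_vol_gt0//= => /eqP.
Qed.

End finite_averages.

Lemma Lavg_ge0 u (Q : set (Rn R n)) h : 0 <= Lavg u Q h.
Proof. exact: poweR_ge0. Qed.

Lemma Lavg_cube u k m h :
  Lavg u (cube k m) h = cube_average (fun x => `|h x| `^ u) k m `^ u^-1.
Proof. by []. Qed.

Lemma Lavg_eq0 u k m h : (0 < u)%R ->
  Lavg u (cube k m) h = 0 <-> cube_average (fun x => `|h x| `^ u) k m = 0.
Proof.
move=> u0; rewrite Lavg_cube; split => [/poweR_eq0_eq0|->].
  by apply; apply: cube_average_ge0 => x; exact: poweR_ge0.
by rewrite poweR0r// invr_neq0// gt_eqF.
Qed.

Lemma dyadic_cube_coarser k (j : nat) (x y : Rn R n) :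
  cube k (dyadic_index k x) y -> cube (k - j%:Z) (dyadic_index (k - j%:Z) x) y.
Proof.
move=> /dyadic_cubeP xy; apply/dyadic_cubeP.
by apply: dyadic_index_coarser.
Qed.

End cube_averages.

(** * The weight condition on dyadic cubes *)

(** The interpolation behind Adams' inequality: a fractional average is dominated
    by a power of the Morrey norm [N] times a power of the plain average [B]. *)
Lemma adams_interpolation {R : realType} (p q t V B N : R) :
  (0 < p)%R -> (0 < q <= t)%R -> (0 < V)%R -> (0 <= B)%R ->
  (V `^ p^-1 * B <= N)%R ->
  (V `^ (p^-1 * (1 - q / t)) * B <= N `^ (1 - q / t) * B `^ (q / t))%R.
Proof.
move=> p0 /andP[q0 qt] V0 B0 hN; have t0 : (0 < t)%R by exact: lt_le_trans qt.
have u0 : (0 <= 1 - q / t)%R by rewrite subr_ge0 ler_pdivrMr// mul1r.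
have -> : (V `^ (p^-1 * (1 - q / t)) * B =
    (V `^ p^-1 * B) `^ (1 - q / t) * B `^ (q / t))%R.
  rewrite powRM ?powR_ge0// (powRrM V) -mulrA -powRD ?subrK ?powRr1//.
  by rewrite oner_eq0.
rewrite ler_wpM2r ?powR_ge0// ge0_ler_powR// nnegrE ?mulr_ge0 ?powR_ge0//.
by apply: le_trans hN; rewrite mulr_ge0 ?powR_ge0.
Qed.

Lemma ler_powR_pos {R : realType} (u x y : R) :
  (0 <= u)%R -> (0 <= x)%R -> (x <= y)%R -> (x `^ u <= y `^ u)%R.
Proof.
by move=> u0 x0 xy; rewrite ge0_ler_powR// nnegrE// (le_trans x0).
Qed.

(** The estimate of [small_cube_key] as a relation between real numbers. *)
Lemma fractional_key {R : realType} (p q t A H K V B N : R) :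
  (0 < p)%R -> (0 < q <= t)%R -> (0 < V)%R -> (0 <= A)%R -> (0 <= H)%R ->
  (0 <= K)%R -> (0 <= B)%R -> (V `^ p^-1 * B <= N)%R ->
  (A * H `^ t^-1 <= K * (V `^ (p^-1 * (1 - q / t)) * B))%R ->
  (A `^ t * H <= K `^ t * N `^ (t - q) * B `^ q)%R.
Proof.
move=> p0 /[dup] hqt /andP[q0 qt] V0 A0 H0 K0 B0 hN hA.
have t0 : (0 < t)%R by exact: lt_le_trans qt.
have h := adams_interpolation p q t V B N p0 hqt V0 B0 hN.
have {h} := le_trans hA (ler_wpM2l K0 h).
move=> /(ge0_ler_powR (ltW t0)); rewrite !nnegrE !mulr_ge0 ?powR_ge0// => /(_ isT isT).
rewrite !powRM ?mulr_ge0 ?powR_ge0// -!powRrM mulVf ?gt_eqF// powRr1//.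
by rewrite mulrBl mul1r divfK ?gt_eqF// mulrA.
Qed.

Lemma powR_mean_product {R : realType} (a q q1 q2 x y : R) :
  (0 < a)%R -> (0 < q1)%R -> (0 < q2)%R ->
  ((x `^ (q1 / a)^-1 * y `^ (q2 / a)^-1) `^ q =
   (x `^ a) `^ (q / q1) * (y `^ a) `^ (q / q2))%R.
Proof.
move=> a0 q10 q20; rewrite powRM; [|exact: powR_ge0..].
rewrite -(powRrM x (q1 / a)^-1%R q) -(powRrM y (q2 / a)^-1%R q).
rewrite -(powRrM x a (q / q1)%R) -(powRrM y a (q / q2)%R).
by congr (_ `^ _ * _ `^ _)%R; field; rewrite !gt_eqF.
Qed.

Section weighted_estimates.
Context {R : realType} {n : nat}.
Local Notation mu := (lebesgue_Rn R n).
Local Notation cube k m := (dyadic_cube k m : set (Rn R n)).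
Local Notation vol k := (dyadic_vol (R:=R) (n:=n) k).
Variables (alpha p q q1 q2 r1 r2 s t a : R) (r : \bar R).
Hypotheses (alpha0 : (0 <= alpha)%R) (p0 : (0 < p)%R) (q0 : (0 < q)%R).
Hypothesis qt : (q <= t)%R.
Hypotheses (r10 : (0 < r1)%R) (r20 : (0 < r2)%R) (a1 : (1 < a)%R).
Hypotheses (ar1 : (a * r1 < q1)%R) (ar2 : (a * r2 < q2)%R).
Hypothesis qE : (q^-1 = q1^-1 + q2^-1)%R.
Hypothesis sE : (s^-1 = p^-1 + fine r^-1 - alpha / n%:R)%R.
Hypothesis tsE : (t / s = q / p)%R.
Variables (v w1 w2 : Rn R n -> R) (f g : Rn R n -> \bar R).
Hypotheses (v0 : forall x, (0 <= v x)%R) (mv : measurable_fun setT v).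
Hypotheses (w10 : forall x, (0 <= w1 x)%R) (mw1 : measurable_fun setT w1).
Hypotheses (w20 : forall x, (0 <= w2 x)%R) (mw2 : measurable_fun setT w2).
Hypotheses (mf : measurable_fun setT f) (mg : measurable_fun setT g).

Local Notation e1 := (r1 * conj_exp (q1 / (a * r1)))%R.
Local Notation e2 := (r2 * conj_exp (q2 / (a * r2)))%R.
Local Notation F := (fun x => `|f x| * (w1 x)%:E).
Local Notation G := (fun x => `|g x| * (w2 x)%:E).
Local Notation iw1 := (fun x => (w1 x)%:E^-1).
Local Notation iw2 := (fun x => (w2 x)%:E^-1).
Local Notation K := (weight_const t q1 q2 a r1 r2 r s v w1 w2).
Local Notation N := (bi_morrey_norm p q1 q2 F G).

Let conj_exp_holder (qi ri : R) : (0 < ri)%R -> (a * ri < qi)%R ->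
  (0 < ri * conj_exp (qi / (a * ri)))%R /\
  (ri^-1 = (qi / a)^-1 + (ri * conj_exp (qi / (a * ri)))^-1)%R.
Proof.
move=> ri0 ariqi; have a0 : (0 < a)%R by rewrite (lt_trans _ a1).
have qi0 : (0 < qi)%R by apply: lt_trans ariqi; rewrite mulr_gt0.
have d0 : (qi / (a * ri) - 1 = (qi - a * ri) / (a * ri))%R.
  by field; rewrite ?gt_eqF.
have d1 : (0 < qi - a * ri)%R by rewrite subr_gt0.
rewrite /conj_exp d0; split.
  by rewrite mulr_gt0// divr_gt0// divr_gt0// mulr_gt0.
by field; rewrite ?gt_eqF.
Qed.

Let t0 : (0 < t)%R. Proof. exact: lt_le_trans qt. Qed.
Let a0 : (0 < a)%R. Proof. exact: lt_trans a1. Qed.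
Let q10 : (0 < q1)%R. Proof. by apply: lt_trans ar1; rewrite mulr_gt0. Qed.
Let q20 : (0 < q2)%R. Proof. by apply: lt_trans ar2; rewrite mulr_gt0. Qed.

Let mF : measurable_fun setT F.
Proof.
by apply: emeasurable_funM; [exact: measurableT_comp|exact/measurable_EFinP].
Qed.

Let mG : measurable_fun setT G.
Proof.
by apply: emeasurable_funM; [exact: measurableT_comp|exact/measurable_EFinP].
Qed.

(** The quantity whose supremum over the cubes containing a point is the maximal
    function. *)
Definition frac_cube_mean (k : int) (m : 'I_n -> int) : \bar R :=
  mu (cube k m) `^ (alpha / n%:R) * Lavg r1 (cube k m) f * Lavg r2 (cube k m) g.
Local Notation A := frac_cube_mean.

Lemma frac_cube_mean_ge0 k m : 0 <= A k m.
Proof. by rewrite !mule_ge0 ?poweR_ge0// Lavg_ge0. Qed.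

Lemma weight_const_ge k m k' m' : cube k m `<=` cube k' m' ->
  ((vol k / vol k') `^ s^-1 * vol k' `^ (fine r^-1))%:E *
    Lavg t (cube k m) (EFin \o v) *
    (Lavg e1 (cube k' m') iw1 * Lavg e2 (cube k' m') iw2) <= K.
Proof.
move=> sub; apply: ereal_sup_ubound; exists (cube k m), (cube k' m'); split => //.
- by exists k, m.
- by exists k', m'.
by rewrite !measure_dyadic_cube inver gt_eqF ?dyadic_vol_gt0//.
Qed.

Lemma bi_morrey_norm_ge k m :
  (vol k `^ p^-1)%:E * Lavg q1 (cube k m) F * Lavg q2 (cube k m) G <= N.
Proof.
apply: ereal_sup_ubound; exists (cube k m); first by exists k, m.
by rewrite measure_dyadic_cube.
Qed.

Local Notation pos_ae w k m := {ae mu, forall x, cube k m x -> (0 < w x)%R}.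

Lemma Lavg_holder1 k m : pos_ae w1 k m ->
  Lavg r1 (cube k m) f <= Lavg (q1 / a) (cube k m) F * Lavg e1 (cube k m) iw1.
Proof.
move=> pos; have [h1 h2] := conj_exp_holder _ _ r10 ar1.
apply: (pmean_weight_holder mu _ _ (measurable_dyadic_cube k m)
  (dyadic_vol_gt0 k) (measure_dyadic_cube k m)) => //.
by rewrite divr_gt0.
Qed.

Lemma Lavg_holder2 k m : pos_ae w2 k m ->
  Lavg r2 (cube k m) g <= Lavg (q2 / a) (cube k m) G * Lavg e2 (cube k m) iw2.
Proof.
move=> pos; have [h1 h2] := conj_exp_holder _ _ r20 ar2.
apply: (pmean_weight_holder mu _ _ (measurable_dyadic_cube k m)
  (dyadic_vol_gt0 k) (measure_dyadic_cube k m)) => //.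
by rewrite divr_gt0.
Qed.

Lemma frac_cube_mean_holder k m : pos_ae w1 k m -> pos_ae w2 k m ->
  A k m <= (vol k `^ (alpha / n%:R))%:E *
    (Lavg (q1 / a) (cube k m) F * Lavg e1 (cube k m) iw1) *
    (Lavg (q2 / a) (cube k m) G * Lavg e2 (cube k m) iw2).
Proof.
move=> pos1 pos2; rewrite /frac_cube_mean measure_dyadic_cube.
apply: lee_pmul; [by rewrite mule_ge0 ?poweR_ge0 ?Lavg_ge0|exact: Lavg_ge0| |exact: Lavg_holder2].
by apply: lee_wpmul2l; [exact: poweR_ge0|exact: Lavg_holder1].
Qed.

Lemma Lavg_jensen qi k m (h : Rn R n -> \bar R) : (0 < qi)%R -> measurable_fun setT h ->
  Lavg (qi / a) (cube k m) h <= Lavg qi (cube k m) h.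
Proof.
move=> qi0 mh; apply: (le_pmean mu _ _ (measurable_dyadic_cube k m)
  (dyadic_vol_gt0 k) (measure_dyadic_cube k m)) => //.
  by rewrite divr_gt0.
by rewrite ltr_pdivrMr// ltr_pMr.
Qed.

(** The contribution of the cubes containing [cube k m]. *)
Lemma large_cube_le k m k' m' : cube k m `<=` cube k' m' ->
  pos_ae w1 k' m' -> pos_ae w2 k' m' ->
  (vol k `^ s^-1)%:E * Lavg t (cube k m) (EFin \o v) * A k' m' <= K * N.
Proof.
move=> sub pos1 pos2.
have V0 := dyadic_vol_gt0 (R:=R) (n:=n) k; have V'0 := dyadic_vol_gt0 (R:=R) (n:=n) k'.
have := lee_pmul _ _ (weight_const_ge _ _ _ _ sub) (bi_morrey_norm_ge k' m').
rewrite !mule_ge0 ?Lavg_ge0 ?lee_fin ?mulr_ge0 ?powR_ge0// => /(_ isT isT) h.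
apply: le_trans h.
have A1 : A k' m' <= (vol k' `^ (alpha / n%:R))%:E *
    (Lavg q1 (cube k' m') F * Lavg e1 (cube k' m') iw1) *
    (Lavg q2 (cube k' m') G * Lavg e2 (cube k' m') iw2).
  apply: (le_trans (frac_cube_mean_holder _ _ pos1 pos2)).
  apply: lee_pmul.
  - by rewrite !mule_ge0 ?Lavg_ge0 ?lee_fin ?powR_ge0.
  - by rewrite mule_ge0 ?Lavg_ge0.
  - apply: lee_wpmul2l; first by rewrite lee_fin powR_ge0.
    by apply: lee_wpmul2r; [exact: Lavg_ge0|exact: Lavg_jensen].
  - by apply: lee_wpmul2r; [exact: Lavg_ge0|exact: Lavg_jensen].
have e : ((vol k `^ s^-1)%:E * (vol k' `^ (alpha / n%:R))%:E =
   ((vol k / vol k') `^ s^-1 * vol k' `^ (fine r^-1))%:E * (vol k' `^ p^-1)%:E :> \bar R).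
  rewrite -!EFinM; congr EFin.
  rewrite powRM ?invr_ge0 ?(ltW V0) ?(ltW V'0)// powRV ?(ltW V'0)// -powRN.
  rewrite -!mulrA -!powRD ?(gt_eqF V'0) ?implybT//; congr (_ * _ `^ _)%R.
  by rewrite sE; ring.
apply: le_trans (lee_wpmul2l _ A1) _.
  by rewrite mule_ge0 ?Lavg_ge0 ?lee_fin ?powR_ge0.
have AC1 (x1 x2 y z1 z2 z3 z4 : \bar R) :
    x1 * y * (x2 * (z1 * z3) * (z2 * z4)) = x1 * x2 * (y * z1 * z2 * z3 * z4).
  by rewrite (AC (2*(1*2*2)) ((1*3)*(2*4*6*5*7))).
have AC2 (x1 x2 y z1 z2 z3 z4 : \bar R) :
    x1 * y * (z3 * z4) * (x2 * z1 * z2) = x1 * x2 * (y * z1 * z2 * z3 * z4).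
  by rewrite (AC (2*2*3) ((1*5)*(2*6*7*3*4))).
by rewrite AC1 AC2 e.
Qed.

(** From now on a cube [Q0] on which [v] does not vanish, with finite constants. *)
Variables (k0 : int) (m0 : 'I_n -> int).
Hypothesis vQ0 : 0 < Lavg t (cube k0 m0) (EFin \o v).
Hypotheses (Kfin : K < +oo) (Nfin : N < +oo).

Lemma Lavg_inv_weight_gt0 k m :
  0 < Lavg e1 (cube k m) iw1 /\ 0 < Lavg e2 (cube k m) iw2.
Proof.
have [h1 _] := conj_exp_holder _ _ r10 ar1.
have [h2 _] := conj_exp_holder _ _ r20 ar2.
by split; apply: (pmean_inv_gt0 mu _ _ (measurable_dyadic_cube k m)
  (dyadic_vol_gt0 k) (measure_dyadic_cube k m)).
Qed.

Let coef_gt0 k k' : (0 < (vol k / vol k') `^ s^-1 * vol k' `^ (fine r^-1))%R.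
Proof. by rewrite mulr_gt0// powR_gt0// ?divr_gt0 ?dyadic_vol_gt0. Qed.

Lemma weight_const_gt0 : 0 < K.
Proof.
apply: lt_le_trans (weight_const_ge k0 m0 k0 m0 (fun x h => h)).
have [h1 h2] := Lavg_inv_weight_gt0 k0 m0.
by rewrite !mule_gt0// lte_fin coef_gt0.
Qed.

Lemma Lavg_v_fin : Lavg t (cube k0 m0) (EFin \o v) < +oo.
Proof.
have := le_lt_trans (weight_const_ge k0 m0 k0 m0 (fun x h => h)) Kfin.
have [h1 h2] := Lavg_inv_weight_gt0 k0 m0.
apply: contraTT; rewrite -!leNgt !leye_eq => /eqP ->.
by rewrite gt0_muley ?lte_fin ?coef_gt0// gt0_mulye// mule_gt0.
Qed.

Lemma Lavg_inv_weight_fin k m : cube k0 m0 `<=` cube k m ->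
  Lavg e1 (cube k m) iw1 < +oo /\ Lavg e2 (cube k m) iw2 < +oo.
Proof.
move=> sub; have := le_lt_trans (weight_const_ge _ _ _ _ sub) Kfin => h.
have [h1 h2] := Lavg_inv_weight_gt0 k m.
have c0 : 0 < ((vol k0 / vol k) `^ s^-1 * vol k `^ (fine r^-1))%:E *
    Lavg t (cube k0 m0) (EFin \o v) by rewrite mule_gt0// lte_fin coef_gt0.
split; apply: contraTT h; rewrite -!leNgt !leye_eq => /eqP ->.
  by rewrite gt0_mulye// gt0_muley.
by rewrite gt0_muley// gt0_muley.
Qed.

Lemma pos_ae_above k m : cube k0 m0 `<=` cube k m -> pos_ae w1 k m /\ pos_ae w2 k m.
Proof.
move=> /Lavg_inv_weight_fin[h1 h2].
have [e10 _] := conj_exp_holder _ _ r10 ar1.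
have [e20 _] := conj_exp_holder _ _ r20 ar2.
by split; [exact: (pmean_inv_fin_ae mu _ _ (measurable_dyadic_cube k m)
    (dyadic_vol_gt0 k) (measure_dyadic_cube k m) _ _ e10 w10 mw1)
  |exact: (pmean_inv_fin_ae mu _ _ (measurable_dyadic_cube k m)
    (dyadic_vol_gt0 k) (measure_dyadic_cube k m) _ _ e20 w20 mw2)].
Qed.

Lemma pos_ae_below k m : cube k m `<=` cube k0 m0 -> pos_ae w1 k m /\ pos_ae w2 k m.
Proof.
move=> sub; have [h1 h2] := pos_ae_above k0 m0 (fun x h => h).
by split; [apply: filterS h1|apply: filterS h2] => x h /sub.
Qed.

(** * The cubes contained in [Q0] *)

Local Notation nf1 := (fun x => `|f x| `^ r1)%E.
Local Notation nf2 := (fun x => `|g x| `^ r2)%E.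
Local Notation nu := (fun x => `|(EFin \o v) x| `^ t)%E.
Local Notation Fa := (fun x => `| `|f x| * (w1 x)%:E | `^ (q1 / a))%E.
Local Notation Ga := (fun x => `| `|g x| * (w2 x)%:E | `^ (q2 / a))%E.
Local Notation Fq := (fun x => `| `|f x| * (w1 x)%:E | `^ q1)%E.
Local Notation Gq := (fun x => `| `|g x| * (w2 x)%:E | `^ q2)%E.
Local Notation av h k m := (fine (cube_average h k m)).
Local Notation sub k m := (cube k m `<=` cube k0 m0).

Let av_ge0 (h : Rn R n -> \bar R) k m : (forall x, 0 <= h x) -> (0 <= av h k m)%R.
Proof. by move=> h0; rewrite fine_ge0// cube_average_ge0. Qed.

Let abse_poweR_ge0 (h : Rn R n -> \bar R) (u : R) : forall x, 0 <= `|h x| `^ u.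
Proof. by move=> x; exact: poweR_ge0. Qed.

Let mpow (h : Rn R n -> \bar R) (u : R) : measurable_fun setT h ->
  measurable_fun setT (fun x => `|h x| `^ u).
Proof. exact: measurable_abse_poweR. Qed.

Let mvE : measurable_fun setT (EFin \o v). Proof. exact/measurable_EFinP. Qed.

Let Lavg_fin (u : R) (h : Rn R n -> \bar R) : (0 < u)%R ->
  Lavg u (cube k0 m0) h < +oo -> cube_average (fun x => `|h x| `^ u) k0 m0 < +oo.
Proof.
by move=> u0; rewrite Lavg_cube; apply: lty_poweRy; rewrite invr_neq0// gt_eqF.
Qed.

Let LavgE' (u : R) (h : Rn R n -> \bar R) k m : measurable_fun setT h ->
  cube_average (fun x => `|h x| `^ u) k0 m0 < +oo -> sub k m ->
  Lavg u (cube k m) h = (av (fun x => `|h x| `^ u)%E k m `^ u^-1)%:E.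
Proof.
move=> mh fin km; rewrite Lavg_cube.
by rewrite (cube_average_fin _ _ _ (mpow h u mh) (abse_poweR_ge0 h u) fin).
Qed.

Let mart (u : R) (h : Rn R n -> \bar R) k m : measurable_fun setT h ->
  cube_average (fun x => `|h x| `^ u) k0 m0 < +oo -> sub k m ->
  av (fun x => `|h x| `^ u)%E k m = (\sum_(e : {ffun 'I_n -> bool})
    #|{ffun 'I_n -> bool}|%:R^-1 *
      av (fun x => `|h x| `^ u)%E (k + 1)%R (dyadic_child m e))%R.
Proof.
by move=> mh fin km; exact: (cube_average_children _ _ _ (mpow h u mh)
  (abse_poweR_ge0 h u) fin _ _ km).
Qed.

Let KE : K = (fine K)%:E.
Proof. by rewrite fineK// ge0_fin_numE// ltW// weight_const_gt0. Qed.

Let N0 : 0 <= N.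
Proof.
apply: le_trans (bi_morrey_norm_ge k0 m0).
by rewrite !mule_ge0 ?Lavg_ge0// lee_fin powR_ge0.
Qed.

Let NE : N = (fine N)%:E. Proof. by rewrite fineK// ge0_fin_numE. Qed.

Let Kr0 : (0 <= fine K)%R. Proof. by rewrite fine_ge0// ltW// weight_const_gt0. Qed.

Section nonzero_mean.
Hypothesis AQ0 : 0 < A k0 m0.

(** With a nonzero mean [A] over [Q0] and finite constants, all the averages over
    [Q0] used below are finite, and those of [F] and [G] are positive. *)
Lemma Lavg_FG_gt0 :
  0 < Lavg q1 (cube k0 m0) F /\ 0 < Lavg q2 (cube k0 m0) G.
Proof.
have [pos1 pos2] := pos_ae_above k0 m0 (fun x h => h).
have := lt_le_trans AQ0 (frac_cube_mean_holder _ _ pos1 pos2) => h.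
split; rewrite lt_def Lavg_ge0 andbT; apply: contraTneq h => z; rewrite -leNgt.
  have := Lavg_jensen q1 k0 m0 F q10 mF; rewrite z => h.
  by rewrite (@le_anti _ _ (Lavg (q1 / a) _ F) 0) ?h ?Lavg_ge0// mul0e mule0 mul0e.
have := Lavg_jensen q2 k0 m0 G q20 mG; rewrite z => h.
by rewrite (@le_anti _ _ (Lavg (q2 / a) _ G) 0) ?h ?Lavg_ge0// mul0e mule0.
Qed.

Lemma Lavg_FG_fin :
  Lavg q1 (cube k0 m0) F < +oo /\ Lavg q2 (cube k0 m0) G < +oo.
Proof.
have [F0 G0] := Lavg_FG_gt0.
have V0 : 0 < (vol k0 `^ p^-1)%:E :> \bar R by rewrite lte_fin powR_gt0// dyadic_vol_gt0.
have h := le_lt_trans (bi_morrey_norm_ge k0 m0) Nfin.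
split; apply: contraTT h; rewrite -!leNgt !leye_eq => /eqP ->.
  by rewrite gt0_muley// gt0_mulye.
by rewrite gt0_muley// mule_gt0.
Qed.

Let finF : cube_average Fq k0 m0 < +oo. Proof. exact: Lavg_fin (Lavg_FG_fin).1. Qed.
Let finG : cube_average Gq k0 m0 < +oo. Proof. exact: Lavg_fin (Lavg_FG_fin).2. Qed.
Let finnu : cube_average nu k0 m0 < +oo. Proof. exact: Lavg_fin Lavg_v_fin. Qed.

Let q1a0 : (0 < q1 / a)%R. Proof. by rewrite divr_gt0. Qed.
Let q2a0 : (0 < q2 / a)%R. Proof. by rewrite divr_gt0. Qed.

Let finFa : cube_average Fa k0 m0 < +oo.
Proof.
apply: (Lavg_fin _ F q1a0); apply: le_lt_trans (Lavg_FG_fin).1.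
exact: Lavg_jensen.
Qed.

Let finGa : cube_average Ga k0 m0 < +oo.
Proof.
apply: (Lavg_fin _ G q2a0); apply: le_lt_trans (Lavg_FG_fin).2.
exact: Lavg_jensen.
Qed.

Let finf : cube_average nf1 k0 m0 < +oo.
Proof.
have [pos1 _] := pos_ae_above k0 m0 (fun x h => h).
have [W1 _] := Lavg_inv_weight_fin k0 m0 (fun x h => h).
apply: (Lavg_fin _ _ r10); apply: le_lt_trans (Lavg_holder1 _ _ pos1) _.
apply: lte_mul_pinfty; rewrite ?Lavg_ge0//.
by rewrite (LavgE' _ _ _ _ mF finFa).
Qed.

Let fing : cube_average nf2 k0 m0 < +oo.
Proof.
have [_ pos2] := pos_ae_above k0 m0 (fun x h => h).
have [_ W2] := Lavg_inv_weight_fin k0 m0 (fun x h => h).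
apply: (Lavg_fin _ _ r20); apply: le_lt_trans (Lavg_holder2 _ _ pos2) _.
apply: lte_mul_pinfty; rewrite ?Lavg_ge0//.
by rewrite (LavgE' _ _ _ _ mG finGa).
Qed.

Let Ar k m : R :=
  (vol k `^ (alpha / n%:R) * av nf1 k m `^ r1^-1 * av nf2 k m `^ r2^-1)%R.

Let Ar_ge0 k m : (0 <= Ar k m)%R.
Proof. by rewrite !mulr_ge0 ?powR_ge0. Qed.

Let AE k m : sub k m -> A k m = (Ar k m)%:E.
Proof.
move=> km; rewrite /frac_cube_mean measure_dyadic_cube.
by rewrite (LavgE' _ _ _ _ mf finf km) (LavgE' _ _ _ _ mg fing km).
Qed.

Let Br k m : R := (av Fa k m `^ (q1 / a)^-1 * av Ga k m `^ (q2 / a)^-1)%R.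

Lemma small_cube_key k m : sub k m ->
  (Ar k m `^ t * av nu k m <=
   fine K `^ t * fine N `^ (t - q) * Br k m `^ q)%R.
Proof.
move=> km; have V0 := dyadic_vol_gt0 (R:=R) (n:=n) k.
have [pos1 pos2] := pos_ae_below _ _ km.
have qt' : (0 < q <= t)%R by rewrite q0.
have nu0 : (0 <= av nu k m)%R by apply: av_ge0; exact: abse_poweR_ge0.
have B0 : (0 <= Br k m)%R by rewrite mulr_ge0 ?powR_ge0.
apply: (fractional_key p q t (Ar k m) (av nu k m) (fine K) (vol k) (Br k m) (fine N)
  p0 qt' V0 (Ar_ge0 k m) nu0 Kr0 B0).
- have := bi_morrey_norm_ge k m; rewrite NE.
  have JF := Lavg_jensen q1 k m F q10 mF; have JG := Lavg_jensen q2 k m G q20 mG.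
  rewrite (LavgE' _ _ _ _ mF finFa km) (LavgE' _ _ _ _ mF finF km) lee_fin in JF.
  rewrite (LavgE' _ _ _ _ mG finGa km) (LavgE' _ _ _ _ mG finG km) lee_fin in JG.
  rewrite (LavgE' _ _ _ _ mF finF km) (LavgE' _ _ _ _ mG finG km) -!EFinM lee_fin.
  move=> hN; apply: (le_trans _ hN); rewrite -[leRHS]mulrA.
  apply: ler_wpM2l; first exact: powR_ge0.
  by apply: ler_pM; [exact: powR_ge0|exact: powR_ge0|exact: JF|exact: JG].
have h1 := frac_cube_mean_holder _ _ pos1 pos2.
have h2 := weight_const_ge _ _ _ _ (fun x (h : cube k m x) => h).
rewrite divff ?gt_eqF// powR1 mul1r in h2.
rewrite (LavgE' _ _ _ _ mvE finnu km) KE in h2.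
rewrite (AE _ _ km) (LavgE' _ _ _ _ mF finFa km) (LavgE' _ _ _ _ mG finGa km) in h1.
set H := av nu k m in h2 *; set W1 := Lavg e1 _ _ in h1 h2; set W2 := Lavg e2 _ _ in h1 h2.
rewrite -lee_fin EFinM.
apply: (@le_trans _ _ ((vol k `^ (p^-1 * (1 - q / t)))%:E * (Br k m)%:E *
  ((vol k `^ fine r^-1)%:E * (H `^ t^-1)%:E * (W1 * W2)))); last first.
  rewrite [leRHS](_ : _ = (vol k `^ (p^-1 * (1 - q / t)))%:E * (Br k m)%:E * (fine K)%:E).
    by apply: lee_wpmul2l => //; rewrite mule_ge0// lee_fin ?mulr_ge0 ?powR_ge0.
  by rewrite -!EFinM; congr EFin; ring.
have H0 : 0 <= (H `^ t^-1)%:E by rewrite lee_fin powR_ge0.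
apply: le_trans (lee_wpmul2r H0 h1) _.
have AC1 (x1 y1 z1 z2 z3 z4 : \bar R) :
    x1 * (z1 * z3) * (z2 * z4) * y1 = x1 * (z1 * z2 * y1 * (z3 * z4)).
  by rewrite (AC (1*2*2*1) (1*(2*4*6*(3*5)))).
have AC2 (x1 x2 y1 b z : \bar R) : x1 * b * (x2 * y1 * z) = x1 * x2 * (b * y1 * z).
  by rewrite (AC (2*(2*1)) ((1*3)*(2*4*5))).
rewrite AC1 AC2 -[(vol k `^ (p^-1 * _))%:E * _]EFinM -powRD ?(gt_eqF V0) ?implybT//.
have -> : (p^-1 * (1 - q / t) + fine r^-1 = alpha / n%:R)%R.
  have -> : (p^-1 * (1 - q / t) = p^-1 - s^-1)%R.
    have -> : (s^-1 = p^-1 * (q / t))%R; last by ring.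
    have tt : (t != 0)%R by rewrite gt_eqF.
    apply: (mulfI tt); rewrite tsE; field.
    by rewrite !gt_eqF.
  by rewrite sE; ring.
by [].
Qed.

Let sg : R := (r1^-1 + r2^-1)^-1%R.

Let sg0 : (0 < sg)%R.
Proof. by rewrite invr_gt0 addr_gt0 ?invr_gt0. Qed.

Let tau_r : (0 < sg / r1 < 1)%R /\ (1 - sg / r1 = sg / r2)%R.
Proof.
have e : (sg / r1 + sg / r2 = 1)%R.
  by rewrite -mulrDr mulVf// gt_eqF// addr_gt0 ?invr_gt0.
have h1 : (0 < sg / r1)%R by rewrite divr_gt0.
have h2 : (0 < sg / r2)%R by rewrite divr_gt0.
by split; [apply/andP; split|]; lra.
Qed.

(** The power of the fractional means that is a supermartingale. *)
Let P k m : R := (Ar k m `^ sg)%R.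

Let PE k m : P k m = ((vol k `^ (alpha / n%:R)) `^ sg *
  (av nf1 k m `^ (sg / r1) * av nf2 k m `^ (1 - sg / r1)))%R.
Proof.
have pw (x y z u : R) : (0 <= x)%R -> (0 <= y)%R -> (0 <= z)%R ->
    ((x * y `^ r1^-1 * z `^ r2^-1) `^ u =
     x `^ u * (y `^ (u / r1) * z `^ (u / r2)))%R.
  move=> x0 y0 z0; rewrite powRM ?mulr_ge0 ?powR_ge0// powRM ?powR_ge0// -mulrA.
  by rewrite -!powRrM (mulrC r1^-1%R) (mulrC r2^-1%R).
rewrite tau_r.2; apply: pw; first exact: powR_ge0.
  by apply: av_ge0; exact: abse_poweR_ge0.
by apply: av_ge0; exact: abse_poweR_ge0.
Qed.

Lemma small_cube_super k m : sub k m ->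
  (\sum_(e : {ffun 'I_n -> bool}) #|{ffun 'I_n -> bool}|%:R^-1 *
     P (k + 1)%R (dyadic_child m e) <= P k m)%R.
Proof.
move=> km; have [ht t1] := tau_r.
have Vle := dyadic_vol_homo _ _ _ _ (dyadic_child_sub (R:=R) k m [ffun=> true]).
have V1 := dyadic_vol_gt0 (R:=R) (n:=n) (k + 1).
set p' := (#|{ffun 'I_n -> bool}|%:R^-1 : R)%R.
have p'0 : (0 <= p')%R by rewrite invr_ge0.
rewrite (eq_bigr (fun e => (vol (k + 1) `^ (alpha / n%:R)) `^ sg *
  (p' * (av nf1 (k + 1) (dyadic_child m e) `^ (sg / r1) *
         av nf2 (k + 1) (dyadic_child m e) `^ (1 - sg / r1)))))%R; last first.
  by move=> e _; rewrite PE mulrCA.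
rewrite -mulr_sumr PE.
apply: ler_pM.
- exact: powR_ge0.
- by apply: sumr_ge0 => e _; rewrite !mulr_ge0 ?powR_ge0.
- have an0 : (0 <= alpha / n%:R)%R by rewrite divr_ge0.
  apply: (ge0_ler_powR (ltW sg0)); rewrite ?nnegrE ?powR_ge0//.
  by apply: (ge0_ler_powR an0) => //; rewrite nnegrE ltW// dyadic_vol_gt0.
apply: le_trans (finite_holder (fun=> p') _ _ _ ht (fun=> p'0) _ _) _.
- by move=> e; exact: av_ge0.
- by move=> e; exact: av_ge0.
by rewrite -(mart _ _ _ _ mf finf km) -(mart _ _ _ _ mg fing km).
Qed.

Let theta : R := (q / q1)%R.

Let theta_q : (0 < theta < 1)%R /\ (1 - theta = q / q2)%R.
Proof.
have e : (q / q1 + q / q2 = 1)%R by rewrite -mulrDr -qE mulfV// gt_eqF.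
have h1 : (0 < q / q1)%R by rewrite divr_gt0.
have h2 : (0 < q / q2)%R by rewrite divr_gt0.
by rewrite /theta; split; [apply/andP; split|]; lra.
Qed.

Let jensen_a qi (h : Rn R n -> \bar R) k m : (0 < qi)%R -> measurable_fun setT h ->
  cube_average (fun x => `|h x| `^ (qi / a)) k0 m0 < +oo ->
  cube_average (fun x => `|h x| `^ qi) k0 m0 < +oo -> sub k m ->
  (av (fun x => `|h x| `^ (qi / a))%E k m `^ a <= av (fun x => `|h x| `^ qi)%E k m)%R.
Proof.
have pw (x y : R) : (0 < qi)%R -> (0 <= y)%R ->
    (x `^ (qi / a)^-1 <= y `^ qi^-1)%R -> (x `^ a <= y)%R.
  move=> qi0 y0 /(ler_powR_pos _ _ _ (ltW qi0) (powR_ge0 _ _)).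
  by rewrite -!powRrM mulVf ?gt_eqF// (powRr1 y0) invf_div divfK// gt_eqF.
move=> qi0 mh fina finq km; have := Lavg_jensen qi k m h qi0 mh.
rewrite (LavgE' _ _ _ _ mh fina km) (LavgE' _ _ _ _ mh finq km) lee_fin.
by apply: (pw _ _ qi0); apply: av_ge0; exact: abse_poweR_ge0.
Qed.

Let X : R := av Fq k0 m0.
Let Y : R := av Gq k0 m0.

Let XY_gt0 : (0 < X)%R /\ (0 < Y)%R.
Proof.
have [F0 G0] := Lavg_FG_gt0.
rewrite (LavgE' _ _ _ _ mF finF (fun x h => h)) lte_fin in F0.
rewrite (LavgE' _ _ _ _ mG finG (fun x h => h)) lte_fin in G0.
split.
  apply: gt0_powR F0; first by rewrite invr_gt0.
  by apply: av_ge0; exact: abse_poweR_ge0.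
apply: gt0_powR G0; first by rewrite invr_gt0.
by apply: av_ge0; exact: abse_poweR_ge0.
Qed.

Let D : R := (fine K `^ t * fine N `^ (t - q) * (X `^ theta * Y `^ (1 - theta)))%R.

Let D0 : (0 <= D)%R. Proof. by rewrite !mulr_ge0 ?powR_ge0. Qed.

(** The bound [D] in terms of the constants of the statement. *)
Lemma local_const_le :
  (vol k0 `^ (t / s) * D <= (fine K * fine N) `^ t)%R.
Proof.
have pw (V x y k N' : R) : (0 <= V)%R -> (0 <= k)%R -> (0 <= N')%R ->
    (V `^ p^-1 * x `^ q1^-1 * y `^ q2^-1 <= N')%R ->
    (V `^ (t / s) * (k `^ t * N' `^ (t - q) * (x `^ theta * y `^ (1 - theta))) <=
     (k * N') `^ t)%R.
  move=> V0 k'0 N'0 h.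
  have VXY0 : (0 <= V `^ p^-1 * x `^ q1^-1 * y `^ q2^-1)%R.
    by rewrite !mulr_ge0 ?powR_ge0.
  have := ler_powR_pos _ _ _ (ltW q0) VXY0 h.
  rewrite powRM ?mulr_ge0 ?powR_ge0// powRM ?powR_ge0// -!powRrM.
  rewrite (mulrC p^-1%R) (mulrC q1^-1%R) (mulrC q2^-1%R) -theta_q.2 -tsE -/theta.
  move=> {}h; rewrite powRM//.
  have -> : (N' `^ t = N' `^ (t - q) * N' `^ q)%R by rewrite -powRD ?subrK// gt_eqF.
  rewrite [leLHS](_ : _ = k `^ t * N' `^ (t - q) *
    (V `^ (t / s) * x `^ theta * y `^ (1 - theta)))%R; last by ring.
  by rewrite [leRHS]mulrA; apply: ler_wpM2l => //; rewrite mulr_ge0 ?powR_ge0.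
apply: pw => //; first by rewrite ltW// dyadic_vol_gt0.
  by rewrite fine_ge0.
have := bi_morrey_norm_ge k0 m0.
rewrite (LavgE' _ _ _ _ mF finF (fun x h => h)) (LavgE' _ _ _ _ mG finG (fun x h => h)).
by rewrite NE.
Qed.

Lemma small_cubes_le (M : nat) (b : R) : (0 < b)%R ->
  \int[mu]_(x in cube k0 m0)
    (cube_max (fun k m => A k m `^ t) M k0 x b%:E * nu x) <=
  (vol k0 * (b * av nu k0 m0 + bellman_const (t / sg) a * D))%:E.
Proof.
move=> b0; have [X0 Y0] := XY_gt0; have [ht t1] := theta_q.
have /andP[th0 th1] := ht.
have u0 : (0 < 1 - theta)%R by rewrite subr_gt0.
pose c1 : R := (D * (theta / X))%R; pose c2 : R := (D * ((1 - theta) / Y))%R.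
have c10 : (0 <= c1)%R by rewrite mulr_ge0 ?D0// divr_ge0 ?(ltW X0)// ltW.
have c20 : (0 <= c2)%R by rewrite mulr_ge0 ?D0// divr_ge0 ?(ltW Y0)// ltW.
have kap0 : (0 < t / sg)%R by rewrite divr_gt0.
have Pk k m : (P k m `^ (t / sg) = Ar k m `^ t)%R.
  by rewrite /P -powRrM mulrCA mulfV ?mulr1// gt_eqF.
have DE : D = (c1 * av Fq k0 m0 + c2 * av Gq k0 m0)%R.
  have pw (d th x y : R) : (0 < x)%R -> (0 < y)%R ->
      (d = d * (th / x) * x + d * ((1 - th) / y) * y)%R.
    by move=> x0 y0; field; rewrite !gt_eqF.
  exact: pw.
have avp (h : Rn R n -> \bar R) (u : R) k m : (0 <= av (fun x => `|h x| `^ u)%E k m)%R.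
  by apply: av_ge0; exact: abse_poweR_ge0.
rewrite [in leRHS]DE.
apply: (integral_cube_max_le_level (fun k m => A k m `^ t) nu (cube k0 m0) P
  (fun k m => av nu k m) (fun k m => av Fa k m) (fun k m => av Fq k m)
  (fun k m => av Ga k m) (fun k m => av Gq k m) (t / sg) a c1 c2
  kap0 a1 c10 c20 (mpow _ t mvE) (abse_poweR_ge0 _ t) _ _ small_cube_super
  _ (fun k m => avp _ _ k m) (fun k m => avp _ _ k m) (fun k m => avp _ _ k m)
  (fun k m => jensen_a q1 F k m q10 mF finFa finF)
  (fun k m => jensen_a q2 G k m q20 mG finGa finG)
  (fun k m => mart _ F k m mF finFa) (fun k m => mart _ F k m mF finF)
  (fun k m => mart _ G k m mG finGa) (fun k m => mart _ G k m mG finG)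
  _ M k0 m0 b (fun x h => h) b0).
- by move=> k m km; rewrite Pk AE.
- by move=> k m; exact: powR_ge0.
- move=> k m km; rewrite integral_cube_average.
  by rewrite (cube_average_fin _ _ _ (mpow _ t mvE) (abse_poweR_ge0 _ t) finnu _ _ km).
move=> k m km; rewrite Pk; apply: (le_trans (small_cube_key _ _ km)).
have -> : (Br k m `^ q = (av Fa k m `^ a) `^ theta * (av Ga k m `^ a) `^ (1 - theta))%R.
  rewrite t1; exact: powR_mean_product.
have := weighted_amgm_normalized theta (av Fa k m `^ a) (av Ga k m `^ a) X Y ht
  (powR_ge0 _ _) (powR_ge0 _ _) X0 Y0.
have KN0 : (0 <= fine K `^ t * fine N `^ (t - q))%R by rewrite mulr_ge0 ?powR_ge0.
move=> /(ler_wpM2l KN0) h; apply: (le_trans h).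
have pw (kn z d x y th x' y' : R) : (kn * z = d)%R ->
    (kn * (z * (th * (x / x') + (1 - th) * (y / y'))) <=
     d * (th / x') * x + d * ((1 - th) / y') * y)%R.
  by move=> <-; rewrite le_eqVlt; apply/orP; left; apply/eqP; ring.
exact: pw.
Qed.

(** The two previous lemmas with the auxiliary quantity [D] hidden. *)
Lemma local_estimate : exists2 T : R,
  (forall (M : nat) (b : R), (0 < b)%R ->
    \int[mu]_(x in cube k0 m0)
      (cube_max (fun k m => A k m `^ t) M k0 x b%:E * nu x) <=
    (vol k0 * (b * av nu k0 m0 + T))%:E) &
  (vol k0 `^ (t / s) * T <=
   bellman_const (t / (r1^-1 + r2^-1)^-1) a * (fine K * fine N) `^ t)%R.
Proof.
exists (bellman_const (t / sg) a * D)%R; first exact: small_cubes_le.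
have pw (V C d y : R) : (0 <= C)%R -> (V * d <= y)%R -> (V * (C * d) <= C * y)%R.
  by move=> C0 h; rewrite mulrCA ler_wpM2l.
apply: pw; [exact: bellman_const_ge0|exact: local_const_le].
Qed.

End nonzero_mean.

(** * The maximal function on [Q0] *)

Local Notation Mfg := (frac_maximal alpha r1 r2 f g).

Lemma frac_maximalE x : Mfg x = ereal_sup (range (fun k => cube_value A k x)).
Proof.
congr ereal_sup; apply/seteqP; split => y.
  move=> [Q [[k [m ->]] /= /dyadic_cubeP xm] <-].
  by exists k; [exact: Logic.I|rewrite /cube_value xm].
move=> [k _ <-]; exists (cube k (dyadic_index k x)) => //.
by split; [exists k, (dyadic_index k x)|apply/dyadic_cubeP].
Qed.

Lemma measurable_frac_maximal : measurable_fun setT Mfg.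
Proof.
rewrite (_ : Mfg = fun x => ereal_sup (range (fun k => cube_value A k x))).
  exact: measurable_dyadic_sup.
by apply/funext => x; exact: frac_maximalE.
Qed.

(** The supremum of the means over the cubes containing [Q0]. *)
Let c0 : \bar R := ereal_sup [set y | exists k m, cube k0 m0 `<=` cube k m /\ y = A k m].

Let vE : exists2 h : R, (0 < h)%R & Lavg t (cube k0 m0) (EFin \o v) = h%:E.
Proof.
exists (fine (Lavg t (cube k0 m0) (EFin \o v))).
  by rewrite fine_gt0// vQ0 Lavg_v_fin.
by rewrite fineK// ge0_fin_numE ?Lavg_ge0// Lavg_v_fin.
Qed.

Let c0_le : (vol k0 `^ s^-1)%:E * Lavg t (cube k0 m0) (EFin \o v) * c0 <= K * N.
Proof.
have [h h0 hE] := vE; rewrite hE -EFinM.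
have V0 : (0 < vol k0 `^ s^-1 * h)%R by rewrite mulr_gt0// powR_gt0// dyadic_vol_gt0.
rewrite -lee_pdivlMl//; apply: ub_ereal_sup => _ [k [m [km ->]]].
rewrite lee_pdivlMl// EFinM -hE.
by have [pos1 pos2] := pos_ae_above k m km; exact: large_cube_le.
Qed.

Let c0_ge : A k0 m0 <= c0.
Proof. by apply: ereal_sup_ubound; exists k0, m0; split. Qed.

Let c0E : exists2 cr : R, (0 <= cr)%R & c0 = cr%:E.
Proof.
have c0p : 0 <= c0 by apply: le_trans c0_ge; exact: frac_cube_mean_ge0.
exists (fine c0); first by rewrite fine_ge0.
rewrite fineK// ge0_fin_numE//; have [h h0 hE] := vE.
have := c0_le; rewrite hE -EFinM => h1.
have KNf : K * N < +oo by rewrite KE NE ltry.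
apply: contraTT (le_lt_trans h1 KNf); rewrite -!leNgt !leye_eq => /eqP ->.
by rewrite gt0_muley// lte_fin mulr_gt0// powR_gt0// dyadic_vol_gt0.
Qed.

Let cube_value_large (k : int) x : cube k0 m0 x -> (k <= k0)%R -> cube_value A k x <= c0.
Proof.
move=> /dyadic_cubeP xm kk0; apply: ereal_sup_ubound.
exists k, (dyadic_index k x); split => //.
have [j jE] : exists j : nat, k = (k0 - j%:Z)%R.
  exists `|(k0 - k)%R|%N; rewrite gez0_abs ?subr_ge0//; ring.
by rewrite jE -xm => y; exact: dyadic_cube_coarser.
Qed.

Let int_shift (k : int) : (k0 <= k)%R -> exists j : nat, k = (k0 + j%:Z)%R.
Proof.
by move=> kk0; exists `|(k - k0)%R|%N; rewrite gez0_abs ?subr_ge0//; ring.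
Qed.

(* Stated with t-th powers so that no continuity of the power function is needed. *)
Let frac_maximal_pow_le x (S : \bar R) : 0 <= S ->
  (forall k, cube_value A k x `^ t * nu x <= S) -> `|Mfg x * (v x)%:E| `^ t <= S.
Proof.
move=> S0 h.
have M0 : 0 <= Mfg x.
  rewrite frac_maximalE; apply: le_trans (ereal_sup_ubound _); last by exists 0%R.
  exact: frac_cube_mean_ge0.
have [vx|vx] := eqVneq (v x) 0%R.
  by rewrite vx mule0 abse0 poweR0r// gt_eqF.
have {}vx : (0 < v x)%R by rewrite lt_def vx v0.
have -> : S = (S `^ t^-1) `^ t by rewrite poweRVK// gt_eqF.
rewrite gee0_abs; last by rewrite mule_ge0// lee_fin ltW.
apply: lee_poweR; [exact: ltW|by rewrite mule_ge0// lee_fin ltW|].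
rewrite -lee_pdivlMr// frac_maximalE; apply: ub_ereal_sup => _ [k _ <-].
rewrite lee_pdivlMr//.
have Ak0 : 0 <= cube_value A k x by exact: frac_cube_mean_ge0.
have -> : cube_value A k x * (v x)%:E = ((cube_value A k x * (v x)%:E) `^ t) `^ t^-1.
  by rewrite poweRK ?gt_eqF// mule_ge0// lee_fin ltW.
apply: lee_poweR; rewrite ?poweR_ge0 ?invr_ge0 ?(ltW t0)//.
have vx' : 0 <= (v x)%:E by rewrite lee_fin ltW.
by rewrite poweRM//; have := h k; rewrite /= ger0_norm ?(ltW vx).
Qed.

Let small_zero k m : A k0 m0 = 0 -> sub k m -> A k m = 0.
Proof.
move=> /eqP; rewrite /frac_cube_mean !measure_dyadic_cube !mule_eq0.
rewrite eqe gt_eqF ?powR_gt0 ?dyadic_vol_gt0//= => /orP[] /eqP z km.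
  have -> : Lavg r1 (cube k m) f = 0.
    apply/(Lavg_eq0 _ _ _ _ r10); move/(Lavg_eq0 _ _ _ _ r10): z.
    exact: (cube_average_sub_eq0 _ _ _ (mpow f r1 mf) (abse_poweR_ge0 f r1)).
  by rewrite mule0 mul0e.
have -> : Lavg r2 (cube k m) g = 0.
  apply/(Lavg_eq0 _ _ _ _ r20); move/(Lavg_eq0 _ _ _ _ r20): z.
  exact: (cube_average_sub_eq0 _ _ _ (mpow g r2 mg) (abse_poweR_ge0 g r2)).
by rewrite mule0.
Qed.

Let mMv : measurable_fun setT (fun x => Mfg x * (v x)%:E).
Proof.
by apply: emeasurable_funM; [exact: measurable_frac_maximal|exact: mvE].
Qed.

Let sub_index (k : int) x : cube k0 m0 x -> (k0 <= k)%R -> sub k (dyadic_index k x).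
Proof.
move=> /dyadic_cubeP xm /int_shift[j kE] y /dyadic_cubeP yx.
apply/dyadic_cubeP; rewrite -xm.
have := dyadic_index_coarser k j _ _ yx.
by rewrite (_ : (k - j%:Z = k0)%R)// kE addrK.
Qed.

Lemma average_maximal_le : exists2 T : R,
  cube_average (fun x => `|Mfg x * (v x)%:E| `^ t) k0 m0 <= T%:E &
  (vol k0 `^ (t / s) * T <=
   (1 + bellman_const (t / (r1^-1 + r2^-1)^-1) a) * (fine K * fine N) `^ t)%R.
Proof.
have V0 := dyadic_vol_gt0 (R:=R) (n:=n) k0.
have [cr cr0 crE] := c0E.
have large : (vol k0 `^ (t / s) * (cr `^ t * av nu k0 m0) <= (fine K * fine N) `^ t)%R.
  have pw (V c h y : R) : (0 <= V)%R -> (0 <= c)%R -> (0 <= h)%R ->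
      (V `^ s^-1 * h `^ t^-1 * c <= y)%R -> (V `^ (t / s) * (c `^ t * h) <= y `^ t)%R.
    move=> V'0 c'0 h0 /(ler_powR_pos _ _ _ (ltW t0)).
    rewrite !mulr_ge0 ?powR_ge0// => /(_ isT).
    rewrite powRM ?mulr_ge0 ?powR_ge0// powRM ?powR_ge0// -!powRrM.
    by rewrite mulVf ?gt_eqF// powRr1// (mulrC s^-1%R) -mulrA (mulrC h).
  apply: pw => //; first exact: ltW.
    by apply: av_ge0; exact: abse_poweR_ge0.
  have := c0_le; rewrite (LavgE' _ _ _ _ mvE (Lavg_fin _ _ t0 Lavg_v_fin) (fun x h => h)).
  by rewrite crE KE NE.
have nuE : \int[mu]_(x in cube k0 m0) nu x = (vol k0 * av nu k0 m0)%:E.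
  rewrite integral_cube_average (cube_average_fin _ _ _ (mpow _ t mvE)
    (abse_poweR_ge0 _ t) (Lavg_fin _ _ t0 Lavg_v_fin) _ _ (fun x h => h)).
  by [].
have C0 := bellman_const_ge0 (t / (r1^-1 + r2^-1)^-1)%R _ a1.
have KN0 : (0 <= (fine K * fine N) `^ t)%R by exact: powR_ge0.
have mMt : measurable_fun setT (fun x => `|Mfg x * (v x)%:E| `^ t) := mpow _ t mMv.
have from_integral (T : R) : \int[mu]_(x in cube k0 m0) (`|Mfg x * (v x)%:E| `^ t) <=
    (vol k0 * T)%:E -> cube_average (fun x => `|Mfg x * (v x)%:E| `^ t) k0 m0 <= T%:E.
  by rewrite integral_cube_average EFinM lee_pmul2l// lte_fin.
(* If [A k0 m0 = 0], the means over all subcubes vanish too. *)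
have [z|z] := eqVneq (A k0 m0) 0.
  exists (cr `^ t * av nu k0 m0)%R; last by apply: (le_trans large); rewrite ler_peMl// lerDl.
  apply: from_integral.
  have -> : (vol k0 * (cr `^ t * av nu k0 m0))%:E =
      \int[mu]_(x in cube k0 m0) ((cr `^ t)%:E * nu x).
    rewrite (ge0_integralZl_EFin mu (measurable_dyadic_cube k0 m0)
      (fun x _ => abse_poweR_ge0 _ t x) (measurable_funTS (mpow _ t mvE)) (powR_ge0 _ _)).
    by rewrite nuE mulrCA.
  apply: ge0_le_integral.
  - exact: measurable_dyadic_cube.
  - by move=> x _; exact: poweR_ge0.
  - exact: measurable_funTS.
  - by apply: measurable_funTS; apply: measurable_funeM; exact: (mpow _ t mvE).
  move=> x xQ; have nux : 0 <= nu x := poweR_ge0 _ _.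
  apply: frac_maximal_pow_le; first by rewrite mule_ge0// lee_fin powR_ge0.
  move=> k; apply: lee_wpmul2r => //; rewrite -poweR_EFin.
  apply: lee_poweR; [exact: ltW|exact: frac_cube_mean_ge0|].
  have [kk0|/ltW kk0] := leP k k0; first by rewrite -crE; exact: cube_value_large.
  by rewrite /cube_value small_zero//; exact: sub_index.
have Apos : 0 < A k0 m0 by rewrite lt_def z frac_cube_mean_ge0.
have [T Tle Tc] := local_estimate Apos.
exists (cr `^ t * av nu k0 m0 + T)%R; last first.
  by rewrite mulrDr mulrDl mul1r; exact: lerD.
have crp : (0 < cr)%R by rewrite -lte_fin -crE; exact: lt_le_trans c0_ge.
have b0 : (0 < cr `^ t)%R by rewrite powR_gt0.
apply: from_integral.
(* The level [cr ^ t] accounts for the cubes containing [Q0], and [M] bounds the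
   number of generations of subcubes. *)
pose H (M : nat) x := cube_max (fun k m => A k m `^ t) M k0 x (cr `^ t)%:E * nu x.
have mH M : measurable_fun setT (H M).
  apply: emeasurable_funM; last exact: (mpow _ t mvE).
  apply: (measurable_cube_max _ M k0 (fun=> (cr `^ t)%:E)); exact: measurable_cst.
have nux x : 0 <= nu x := poweR_ge0 _ _.
have H0 M x : 0 <= H M x.
  rewrite mule_ge0//; apply: le_trans (le_cube_max _ _ _ _ _).
  by rewrite lee_fin powR_ge0.
have ndH x : {homo H^~ x : M M' / (M <= M')%N >-> M <= M'}.
  by move=> M M' MM'; apply: lee_wpmul2r => //; exact: cube_max_nd.
have limH x : limn (H^~ x) = ereal_sup (range (H^~ x)).
  by apply/cvg_lim => //; exact: ereal_nondecreasing_cvgn.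
apply: (@le_trans _ _ (\int[mu]_(x in cube k0 m0) limn (H^~ x))).
  apply: ge0_le_integral.
  - exact: measurable_dyadic_cube.
  - by move=> x _; exact: poweR_ge0.
  - exact: measurable_funTS.
  - apply: (@emeasurable_fun_cvg _ _ _ _ H) => [M|x _]; first exact: measurable_funTS.
    by rewrite limH; exact: ereal_nondecreasing_cvgn.
  move=> x xQ; rewrite limH.
  have ub M : H M x <= ereal_sup (range (H^~ x)).
    by apply: ereal_sup_ubound; exists M.
  apply: frac_maximal_pow_le; first exact: le_trans (ub 0%N).
  move=> k; have [kk0|/ltW kk0] := leP k k0.
    apply: le_trans (ub 0%N); apply: lee_wpmul2r => //=; rewrite -poweR_EFin -crE.
    by apply: lee_poweR; [exact: ltW|exact: frac_cube_mean_ge0|exact: cube_value_large].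
  have [j ->] := int_shift k kk0.
  apply: le_trans (ub j.+1); apply: lee_wpmul2r => //.
  exact: (cube_max_ge (fun k m => A k m `^ t)).
rewrite monotone_convergence.
- apply: lime_le.
    apply: ereal_nondecreasing_is_cvgn => M M' MM'; apply: ge0_le_integral.
    + exact: measurable_dyadic_cube.
    + by move=> x _; exact: H0.
    + exact: measurable_funTS.
    + exact: measurable_funTS.
    + by move=> x _; exact: ndH.
  by apply: nearW => M; exact: Tle.
- exact: measurable_dyadic_cube.
- by move=> M; exact: measurable_funTS.
- by move=> M x _; exact: H0.
- by move=> x _; exact: ndH.
Qed.

Lemma maximal_cube_le :
  mu (cube k0 m0) `^ s^-1 * Lavg t (cube k0 m0) (fun x => Mfg x * (v x)%:E) <=
  ((1 + bellman_const (t / (r1^-1 + r2^-1)^-1) a) `^ t^-1)%:E * K * N.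
Proof.
have V0 := dyadic_vol_gt0 (R:=R) (n:=n) k0.
have [T T1 T2] := average_maximal_le.
have T0 : (0 <= T)%R.
  rewrite -lee_fin; apply: le_trans T1; apply: cube_average_ge0 => x; exact: poweR_ge0.
have C0 := bellman_const_ge0 (t / (r1^-1 + r2^-1)^-1)%R _ a1.
rewrite measure_dyadic_cube Lavg_cube poweR_EFin.
apply: (@le_trans _ _ ((vol k0 `^ s^-1)%:E * (T `^ t^-1)%:E)).
  apply: lee_wpmul2l; first by rewrite lee_fin powR_ge0.
  rewrite -poweR_EFin; apply: lee_poweR => //; first by rewrite invr_ge0 ltW.
  by apply: cube_average_ge0 => x; exact: poweR_ge0.
rewrite KE NE -!EFinM lee_fin.
have pw (V x C k y : R) : (0 <= V)%R -> (0 <= x)%R -> (0 <= C)%R -> (0 <= k)%R ->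
    (0 <= y)%R -> (V `^ (t / s) * x <= C * (k * y) `^ t)%R ->
    (V `^ s^-1 * x `^ t^-1 <= C `^ t^-1 * k * y)%R.
  move=> V'0 x0 C'0 k'0 y0 h.
  have u0 : (0 <= t^-1)%R by rewrite invr_ge0 ltW.
  have := ler_powR_pos _ _ _ u0 _ h; rewrite mulr_ge0 ?powR_ge0// => /(_ isT).
  rewrite powRM ?powR_ge0// powRM ?powR_ge0// -!powRrM mulfV ?gt_eqF//.
  by rewrite powRr1 ?mulr_ge0// mulrA [(t / s / t)%R]mulrAC mulfV ?gt_eqF// mul1r.
apply: pw => //; first exact: ltW.
  by rewrite addr_ge0.
by rewrite fine_ge0.
Qed.

End weighted_estimates.

(** * The weighted Morrey estimate *)

Theorem theorem2p8 (R : realType) (n : nat)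
  (alpha p q q1 q2 r1 r2 s t a : R) (r : \bar R)
  (halpha : (0 <= alpha < n%:R)%R)
  (hqp : (0 < q <= p)%R)
  (hts : (0 < t <= s)%R) (hsr : s%:E < r)
  (hrq1 : (0 < r1 < q1)%R) (hrq2 : (0 < r2 < q2)%R)
  (hq : (q^-1 = q1^-1 + q2^-1)%R)
  (ha : (1 < a < Num.min (q1 / r1) (q2 / r2))%R)
  (hr : (fine r^-1 <= alpha / n%:R)%R)
  (hs : (s^-1 = p^-1 + fine r^-1 - alpha / n%:R)%R)
  (hqt : (t / s = q / p)%R) :
  exists C : R, (0 < C)%R /\
    forall v w1 w2 : Rn R n -> R,
      weight v -> weight w1 -> weight w2 ->
      weight_const t q1 q2 a r1 r2 r s v w1 w2 < +oo ->
      forall f g : Rn R n -> \bar R,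
        measurable_fun setT f -> measurable_fun setT g ->
        morrey_norm t s (fun x => frac_maximal alpha r1 r2 f g x * (v x)%:E) <=
        C%:E * weight_const t q1 q2 a r1 r2 r s v w1 w2 *
          bi_morrey_norm p q1 q2 (fun x => `|f x| * (w1 x)%:E)
                                 (fun x => `|g x| * (w2 x)%:E).
Proof.
have /andP[alpha0 alphan] := halpha; have /andP[q0 qp] := hqp.
have /andP[t0 ts] := hts; have /andP[r10 rq1] := hrq1; have /andP[r20 rq2] := hrq2.
have /andP[a1] := ha; rewrite lt_min => /andP[]; rewrite !ltr_pdivlMr// => ar1 ar2.
have p0 : (0 < p)%R by exact: lt_le_trans qp.
have s0 : (0 < s)%R by exact: lt_le_trans ts.
(* The condition [alpha / n >= 1 / r] means [s >= p], and [t / s = q / p]. *)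
have qt : (q <= t)%R.
  have tE : t = (q / p * s)%R by rewrite -hqt divfK// gt_eqF.
  rewrite tE -mulrA ler_peMr ?(ltW q0)// mulrC ler_pdivlMr// mul1r.
  by rewrite -lef_pV2 ?posrE// hs; lra.
pose C := (1 + bellman_const (t / (r1^-1 + r2^-1)^-1) a)%R.
have C0 : (0 < C)%R by rewrite ltr_pwDl// bellman_const_ge0.
exists (C `^ t^-1)%R; split; first exact: powR_gt0.
move=> v w1 w2 [v0 [mv _]] [w10 [mw1 _]] [w20 [mw2 _]] Kfin f g mf mg.
set K := weight_const _ _ _ _ _ _ _ _ _ _ _; set N := bi_morrey_norm _ _ _ _ _.
apply: ub_ereal_sup => _ [_ [k [m ->]] <-].
have K0 : 0 <= K.
  apply: (le_trans _ (weight_const_ge q1 q2 r1 r2 s t a r v w1 w2 k m k m (fun x h => h))).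
  by rewrite !mule_ge0 ?Lavg_ge0// lee_fin mulr_ge0 ?powR_ge0.
have N0 : 0 <= N.
  apply: (le_trans _ (bi_morrey_norm_ge p q1 q2 w1 w2 f g k m)).
  by rewrite !mule_ge0 ?Lavg_ge0// lee_fin powR_ge0.
have CKN : 0 <= (C `^ t^-1)%:E * K * N by rewrite !mule_ge0// lee_fin powR_ge0.
have mvE : measurable_fun setT (EFin \o v) by exact/measurable_EFinP.
have [v_eq0|v_neq0] := eqVneq (Lavg t (dyadic_cube k m) (EFin \o v)) 0.
  (* [v] vanishes almost everywhere on the cube, so the left-hand side is 0, even
     where the maximal function is infinite. *)
  have /(average_eq0 _ _ _ (measurable_dyadic_cube k m) (dyadic_vol_gt0 k)
    (measure_dyadic_cube k m) _ (measurable_abse_poweR _ t mvE)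
    (fun x => poweR_ge0 _ _)) v_ae0 := (Lavg_eq0 _ _ _ _ t0).1 v_eq0.
  have -> : Lavg t (dyadic_cube k m) (fun x => frac_maximal alpha r1 r2 f g x * (v x)%:E) = 0.
    apply/(Lavg_eq0 _ _ _ _ t0).
    apply: (average_ae0 _ _ _ (measurable_dyadic_cube k m) (dyadic_vol_gt0 k)
      (measure_dyadic_cube k m)).
    - apply: measurable_abse_poweR; apply: emeasurable_funM; last exact: mvE.
      exact: measurable_frac_maximal.
    - by move=> x; exact: poweR_ge0.
    apply: filterS v_ae0 => x /[apply] /poweR_eq0_eq0 vx.
    have /eqP := vx (abse_ge0 _); rewrite abse_eq0 => /eqP /= ->.
    by rewrite mule0 abse0 poweR0r// gt_eqF.
  by rewrite mule0.
have v_gt0 : 0 < Lavg t (dyadic_cube k m) (EFin \o v).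
  by rewrite lt_def v_neq0 Lavg_ge0.
have [Ny|Ny] := eqVneq N +oo.
  have Kgt0 : 0 < K by exact: (weight_const_gt0 q1 q2 r1 r2 s t a r r10 r20 a1 ar1 ar2
    v w1 w2 w10 mw1 w20 mw2 k m v_gt0).
  by rewrite Ny gt0_muley ?leey// mule_gt0// lte_fin powR_gt0.
apply: (maximal_cube_le alpha p q q1 q2 r1 r2 s t a r alpha0 p0 q0 qt r10 r20 a1 ar1 ar2
  hq hs hqt v w1 w2 f g v0 mv w10 mw1 w20 mw2 mf mg k m v_gt0 Kfin).
by rewrite ltey.
Qed.
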